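(* Let $n\geq 1$, let $s\geq 0$, and let $K\subset\mathbb{R}^n$ be a compact set. There exists a constant $\tilde c=\tilde c(n,K,s)>0$ such that for all $t$ with $s\geq t\geq 0$ and all $u\in H^s_K(\mathbb{R}^n)$ $$\|(-\Delta)^{t/2}u\|_{L^2(\mathbb{R}^n)}\leq\tilde c\,\|(-\Delta)^{s/2}u\|_{L^2(\mathbb{R}^n)}.$$
   Context: $H^s(\mathbb{R}^n)$ is the $L^2$ Sobolev space with norm $\|(1+|\cdot|^2)^{s/2}\hat u\|_{L^2}$ (up to normalization of the Fourier transform), and $H^s_K(\mathbb{R}^n)=\{u\in H^s(\mathbb{R}^n):\mathrm{spt}(u)\subset K\}$. For $a\ge 0$, $(-\Delta)^{a}u=\mathcal{F}^{-1}(|\cdot|^{2a}\hat u)$, where $\mathcal{F}u=\hat u$ is the Fourier transform. *)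

(* Defs.v *)
From HB Require Import structures.
From mathcomp Require Import all_boot all_order all_algebra.
From mathcomp Require Import all_classical all_reals all_analysis.
From mathcomp Require Import complex.

Set Implicit Arguments.
Unset Strict Implicit.
Unset Printing Implicit Defensive.

Import Order.TTheory GRing.Theory Num.Theory.
Import numFieldNormedType.Exports.

Local Open Scope classical_set_scope.
Local Open Scope ring_scope.

(* R^n is 'rV[R]_n, with the library's topology and the product (= Borel)
   sigma-algebra, generated by the coordinate maps. *)

Definition rV_display : measure_display.
Proof. exact: default_measure_display. Qed.

Section rV_measurable.
Context (R : realType) (n : nat).

Definition rV_coord (i : 'I_n) (x : 'rV[R]_n) : measurableTypeR R := x ord0 i.

Let rV_set0 : g_sigma_preimage rV_coord set0.
Proof. exact: sigma_algebra0. Qed.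

Let rV_setC A : g_sigma_preimage rV_coord A -> g_sigma_preimage rV_coord (~` A).
Proof. exact: sigma_algebraC. Qed.

Let rV_bigcup (F : _^nat) : (forall i, g_sigma_preimage rV_coord (F i)) ->
  g_sigma_preimage rV_coord (\bigcup_i (F i)).
Proof. exact: sigma_algebra_bigcup. Qed.

HB.instance Definition _ := @isMeasurable.Build rV_display 'rV[R]_n
  (g_sigma_preimage rV_coord) rV_set0 rV_setC rV_bigcup.

End rV_measurable.

Section rV_measurable_fun.
Context (R : realType) (n : nat).

Lemma measurable_rV_coord i : measurable_fun [set: 'rV[R]_n] (@rV_coord R n i).
Proof.
move=> _ Y mY; rewrite setTI; apply: sub_sigma_algebra => /=.
rewrite -bigcup_seq/=; exists i => /=; first by rewrite mem_index_enum.
by exists Y => //; rewrite setTI.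
Qed.

Lemma measurable_to_rV d (T : measurableType d) (f : T -> 'rV[R]_n) :
  (forall i, measurable_fun [set: T] (@rV_coord R n i \o f)) ->
  measurable_fun [set: T] f.
Proof.
move=> mf.
have sub : g_sigma_preimage (fun i => @rV_coord R n i \o f) `<=` measurable.
  apply: smallest_sub; first exact: sigma_algebra_measurable.
  case: n f mf => [|m] f mf; first by rewrite big_ord0.
  rewrite -bigcup_mkord_ord; apply: bigcup_sub => i Ii.
  by move=> A [B mB <-]; exact: mf.
by move: sub; rewrite g_sigma_preimage_comp => sub _ A mA; apply: sub; exists A.
Qed.

End rV_measurable_fun.

Section rV_lebesgue.
Context (R : realType).

Definition rV_cons n (p : measurableTypeR R * 'rV[R]_n) : 'rV[R]_n.+1 :=
  row_mx (p.1 : R)%:M p.2.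

Definition rV_uncons n (x : 'rV[R]_n.+1) : measurableTypeR R * 'rV[R]_n :=
  (x ord0 ord0, @rsubmx R 1 1 n x).

Lemma rV_consK n : cancel (@rV_cons n) (@rV_uncons n).
Proof.
move=> [a v]; rewrite /rV_uncons /rV_cons row_mxKr; congr pair.
transitivity (row_mx (a : R)%:M v ord0 (lshift n (ord0 : 'I_1))).
  by congr (row_mx _ _ _ _); exact/val_inj.
by rewrite row_mxEl mxE eqxx mulr1n.
Qed.

Lemma measurable_rV_cons n : measurable_fun setT (@rV_cons n).
Proof.
apply: measurable_to_rV => i.
case: (@split_ordP 1 n i) => j ->.
  rewrite [X in measurable_fun _ X](_ : _ = fst) //.
  apply/funext => x /=; transitivity ((x.1 : R)%:M ord0 j : R).
    exact: row_mxEl.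
  by rewrite !ord1 mxE.
rewrite [X in measurable_fun _ X](_ : _ = rV_coord j \o snd).
  by apply: measurableT_comp => //; exact: measurable_rV_coord.
by apply/funext => x /=; exact: row_mxEr.
Qed.

HB.instance Definition _ n :=
  isMeasurableFun.Build _ _ _ _ (@rV_cons n) (@measurable_rV_cons n).

Lemma measurable_rV_uncons n : measurable_fun setT (@rV_uncons n).
Proof.
apply/measurable_fun_pairP; split.
  exact: (measurable_rV_coord ord0).
apply: measurable_to_rV => i.
rewrite [X in measurable_fun _ X](_ : _ = rV_coord (rshift 1 i)).
  exact: measurable_rV_coord.
by apply/funext => x /=; rewrite /rV_coord mxE.
Qed.

Section step.
Context (n : nat) (mu : {sigma_finite_measure set 'rV[R]_n -> \bar R}).

Definition rV_lebesgue_step : set 'rV[R]_n.+1 -> \bar R :=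
  pushforward ((@lebesgue_measure R) \x mu)%E (@rV_cons n).

Let step0 : rV_lebesgue_step set0 = 0%E.
Proof. exact: measure0. Qed.

Let step_ge0 A : (0 <= rV_lebesgue_step A)%E.
Proof. exact: measure_ge0. Qed.

Let step_sigma_additive : semi_sigma_additive rV_lebesgue_step.
Proof. exact: measure_semi_sigma_additive. Qed.

HB.instance Definition _ := isMeasure.Build _ _ _ rV_lebesgue_step
  step0 step_ge0 step_sigma_additive.

Let step_sigma_finite : sigma_finite setT rV_lebesgue_step.
Proof.
have /sigma_finiteP[F [TF ndF Foo]] := sigma_finiteT (@lebesgue_measure R).
have /sigma_finiteP[G [TG ndG Goo]] := sigma_finiteT mu.
exists (fun k => @rV_uncons n @^-1` (F k `*` G k)).
  rewrite -preimage_bigcup (_ : \bigcup_k _ = setT) ?preimage_setT//.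
  rewrite -setXTT TF TG predeqE => -[x y]; split.
    by move=> [k _ []/= ? ?]; split; exists k.
  move=> [/= [k _ Fkx] [l _ Gly]]; exists (maxn k l) => //; split.
  - by move: x Fkx; exact/subsetPset/ndF/leq_maxl.
  - by move: y Gly; exact/subsetPset/ndG/leq_maxr.
move=> k; have [mF Fk] := Foo k; have [mG Gk] := Goo k; split.
  rewrite -[X in measurable X]setTI; apply: measurable_rV_uncons => //.
  exact: measurableX.
rewrite /rV_lebesgue_step /pushforward -comp_preimage.
rewrite (_ : _ \o _ = id); last by apply/funext => p /=; exact: rV_consK.
by rewrite preimage_id product_measure1E// lte_mul_pinfty// ge0_fin_numE.
Qed.

HB.instance Definition _ := Measure_isSigmaFinite.Build _ _ _ rV_lebesgue_step
  step_sigma_finite.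

End step.

(* Lebesgue measure on R^n: mass 1 at the only point of R^0, and on R^n.+1 the
   product of the Lebesgue measures on R and R^n. *)
Fixpoint rV_lebesgue n : {sigma_finite_measure set 'rV[R]_n -> \bar R} :=
  if n is m.+1 then rV_lebesgue_step (rV_lebesgue m) else \d_(0 : 'rV[R]_0).

End rV_lebesgue.

Local Open Scope complex_scope.

Section rV_euclidean.
Context {R : realType} {n : nat}.
Implicit Types x y : 'rV[R]_n.

Definition dotr x y : R := \sum_i x ord0 i * y ord0 i.

(* The norm `|x| of the library on 'rV[R]_n is the sup norm. *)
Definition euclid x : R := Num.sqrt (dotr x x).

End rV_euclidean.

Section complex_L2.
Context {R : realType} {n : nat}.
Let mu := @rV_lebesgue R n.
Implicit Types f g : 'rV[R]_n -> R[i].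

Definition cmeasurable f : Prop :=
  measurable_fun setT (fun x => complex.Re (f x)) /\
  measurable_fun setT (fun x => complex.Im (f x)).

Definition cintegral f : R[i] :=
  (\int[mu]_x complex.Re (f x)) +i* (\int[mu]_x complex.Im (f x)).

Definition L2norm f : \bar R :=
  ('N[mu]_2%:E[EFin \o (@Normc.normc R \o f)])%E.

Definition L2 : set ('rV[R]_n -> R[i]) :=
  [set f | cmeasurable f /\ (L2norm f < +oo)%E].

(* Essential support: the complement of the largest open set on which f
   vanishes almost everywhere. *)
Definition spt f : set 'rV[R]_n :=
  ~` \bigcup_(U in [set U | open U /\ {ae mu, forall x, U x -> f x = 0}]) U.

End complex_L2.

Section fourier.
Context {R : realType} {n : nat}.
Implicit Types f g : 'rV[R]_n -> R[i].

Definition expi (t : R) : R[i] := cos t +i* sin t.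

Definition trunc (N : nat) f : 'rV[R]_n -> R[i] :=
  fun x => if euclid x <= N%:R then f x else 0.

Definition fourierL1 f : 'rV[R]_n -> R[i] :=
  fun xi => cintegral (fun x => expi (- dotr x xi) * f x).

Definition inv_fourierL1 g : 'rV[R]_n -> R[i] :=
  fun x => (((2 * pi) ^+ n)^-1)%:C * cintegral (fun xi => expi (dotr x xi) * g xi).

(* The Fourier transform on L^2 and its inverse are the limits in L^2 of the
   integrals over the balls of radius N.  They are classes modulo equality
   almost everywhere, of which a representative is chosen; the default value 0
   is never used for f in L^2, by Plancherel's theorem. *)
Definition fourier f : 'rV[R]_n -> R[i] :=
  xget (fun=> 0) [set g | L2 g /\
    (fun N : nat => L2norm (fun xi => fourierL1 (trunc N f) xi - g xi))
      @ \oo --> 0%E].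

Definition inv_fourier g : 'rV[R]_n -> R[i] :=
  xget (fun=> 0) [set f | L2 f /\
    (fun N : nat => L2norm (fun x => inv_fourierL1 (trunc N g) x - f x))
      @ \oo --> 0%E].

(* H^s for s >= 0, where it consists of functions in L^2. *)
Definition sobolev (s : R) : set ('rV[R]_n -> R[i]) :=
  [set u | L2 u /\
    L2 (fun xi => ((1 + euclid xi ^+ 2) `^ (s / 2))%:C * fourier u xi)].

Definition sobolev_in (s : R) (K : set 'rV[R]_n) : set ('rV[R]_n -> R[i]) :=
  [set u | sobolev s u /\ spt u `<=` K].

Definition fractional_laplacian (a : R) (u : 'rV[R]_n -> R[i]) :
    'rV[R]_n -> R[i] :=
  inv_fourier (fun xi => (euclid xi `^ (2 * a))%:C * fourier u xi).

End fourier.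

(* Main.v *)
Require Import Defs.
From HB Require Import structures.
From mathcomp Require Import all_boot all_order all_algebra.
From mathcomp Require Import all_classical all_reals all_analysis.
From mathcomp Require Import measurable_realfun complex ring lra.

Set Implicit Arguments.
Unset Strict Implicit.
Unset Printing Implicit Defensive.

Import Order.TTheory GRing.Theory Num.Theory.
Import numFieldNormedType.Exports.

Local Open Scope classical_set_scope.
Local Open Scope ring_scope.
Local Open Scope complex_scope.

(** By Plancherel's theorem the norm of (-Delta)^(a/2) u is a fixed multiple of
the norm of |xi|^a times the Fourier transform û of u
([L2norm_fractional_laplacian]).  Since |xi|^(2t) <= 1 + |xi|^(2s) for
0 <= t <= s ([energy_freq_le]), only an inequality of Poincare type is needed
([poincare]): the norm of û is at most a constant times the norm of |xi|^s û,
the constant depending on a box containing K, and on s.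

Low frequencies carry at most half of the energy of û.  Indeed u vanishes
almost everywhere off a box of finite volume V, so its L1 norm is at most
sqrt V times its L2 norm, and û is bounded by 2 sqrt V times the L2 norm of u
([low_frequency]); over a box of half-side del its energy is therefore at most
4 V (2 del)^n times that of u, which, as n >= 1, is by Plancherel at most
half of the energy of û once del is small.  The high frequencies satisfy |xi| >= del, where
|û| <= del^(-s) |xi|^s |û|; the low half is absorbed in the left-hand side.

Both steps rest on the Plancherel identity, for the transform that is defined
as an L2 limit of integrals over growing balls.  It is established as follows.

On the line, for a real, bounded function a of bounded support, the square of
the modulus of the transform is integrated over xi >= 0 against exp(- e xi).  By
Fubini this is the integral of a(x) a(y) against the Poisson kernel
e / (e^2 + (x - y)^2), hence the integral of A(e w) / (1 + w^2), where A is the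
autocorrelation of a.  As e tends to 0 the first expression increases to the
integral without weight, and the last one tends to pi A(0), because A is
continuous at 0 ([autocorr_cvg], [real_plancherel]).  Complex functions follow
by adding the contributions of xi and - xi, where the cross terms cancel
([fourier_line_plancherel]), and R^n by induction on n, transforming one
coordinate at a time ([bounded_plancherel]).

Boundedness is removed by discarding the large values of the function, with
Fatou's lemma for the upper bound ([plancherel_upper], [plancherel_L2box]).  The
restriction to bounded supports is removed by completeness of L2
([riesz_fischer]): the transforms of the truncations to balls form a Cauchy
sequence, hence converge, and the limit inherits the norm identity
([extension_exists], [extension_nrm]).  The inverse transform is conjugate, up to
a constant, to the direct one ([inv_fourierL1E]), so the same argument applies
to it. *)

(** * Complex numbers *)

Section scalars.
Context {R : realType}.
Implicit Types z w : R[i].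
Local Notation Re := (@complex.Re R).
Local Notation Im := (@complex.Im R).

(** The squared modulus.  It is a polynomial in the real and imaginary
parts, so that measurability, limits and Fubini need no square roots. *)
Definition sqn z : R := Re z ^+ 2 + Im z ^+ 2.

Lemma sqn_ge0 z : 0 <= sqn z.
Proof. by rewrite addr_ge0 ?sqr_ge0. Qed.

Lemma sqnE z : Normc.normc z ^+ 2 = sqn z.
Proof. by case: z => a b; rewrite sqr_sqrtr ?addr_ge0 ?sqr_ge0. Qed.

Lemma normc_ge0 z : 0 <= Normc.normc z.
Proof. by case: z => a b; exact: sqrtr_ge0. Qed.

Lemma sqnM z w : sqn (z * w) = sqn z * sqn w.
Proof. by rewrite -!sqnE Normc.normcM exprMn. Qed.

Lemma sqnB_sym z w : sqn (z - w) = sqn (w - z).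
Proof. by case: z w => [a b] [c d]; rewrite /sqn /=; ring. Qed.

Lemma sqnD_le z w : sqn (z + w) <= 2 * sqn z + 2 * sqn w.
Proof.
case: z w => [a b] [c d]; rewrite /sqn /=.
by have := sqr_ge0 (a - c); have := sqr_ge0 (b - d); nra.
Qed.

Lemma normc_expi t : Normc.normc (expi t : R[i]) = 1.
Proof. by rewrite /expi /= cos2Dsin2 sqrtr1. Qed.

Lemma expiD (s t : R) : expi (s + t) = expi s * expi t.
Proof. by rewrite /expi cosD sinD; simpc; rewrite [sin s * cos t + _]addrC. Qed.

Lemma normr_Re_le z : `|Re z| <= Normc.normc z.
Proof.
by case: z => a b /=; rewrite -sqrtr_sqr ler_wsqrtr// lerDl sqr_ge0.
Qed.

Lemma normr_Im_le z : `|Im z| <= Normc.normc z.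
Proof.
by case: z => a b /=; rewrite -sqrtr_sqr ler_wsqrtr// lerDr sqr_ge0.
Qed.

Lemma normc_le_ReIm z : Normc.normc z <= `|Re z| + `|Im z|.
Proof.
rewrite -(@ler_pXn2r _ 2)// ?nnegrE ?normc_ge0 ?addr_ge0// sqnE /sqn.
rewrite -(real_normK (num_real (Re z))) -(real_normK (num_real (Im z))).
by have := normr_ge0 (Re z); have := normr_ge0 (Im z); nra.
Qed.

Lemma cReB z w : Re (z - w) = Re z - Re w. Proof. by case: z w => [a b] [c d]. Qed.
Lemma cImB z w : Im (z - w) = Im z - Im w. Proof. by case: z w => [a b] [c d]. Qed.
Lemma cReD z w : Re (z + w) = Re z + Re w. Proof. by case: z w => [a b] [c d]. Qed.
Lemma cImD z w : Im (z + w) = Im z + Im w. Proof. by case: z w => [a b] [c d]. Qed.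
Lemma cReM z w : Re (z * w) = Re z * Re w - Im z * Im w.
Proof. by case: z w => [a b] [c d]. Qed.
Lemma cImM z w : Im (z * w) = Re z * Im w + Im z * Re w.
Proof. by case: z w => [a b] [c d]. Qed.

Lemma complex_eq z w : Re z = Re w -> Im z = Im w -> z = w.
Proof. by case: z w => [a b] [c d] /= -> ->. Qed.

End scalars.

(** * Real-valued integrals and products *)

Section real_integrals.
Context {R : realType}.

(** The integral is the difference of the integrals of the positive and negative
parts, each of which is measurable in the parameter by Tonelli's theorem. *)
Lemma measurable_Rint d1 d2 (T1 : measurableType d1) (T2 : measurableType d2)
    (m2 : {sigma_finite_measure set T2 -> \bar R}) (f : T1 * T2 -> R) :
  measurable_fun setT f ->
  measurable_fun setT (fun x => \int[m2]_y f (x, y)).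
Proof.
move=> mf.
have mEf : measurable_fun setT (fun z => (f z)%:E) by exact/measurable_EFinP.
apply: measurableT_comp => //=.
rewrite (_ : (fun x => _) = (fun x => fubini_F m2 ((fun z => (f z)%:E)^\+)%E x -
    fubini_F m2 ((fun z => (f z)%:E)^\-)%E x)%E).
  apply: emeasurable_funB.
    by apply: measurable_fun_fubini_tonelli_F => //; exact: measurable_funepos.
  by apply: measurable_fun_fubini_tonelli_F => //; exact: measurable_funeneg.
apply/funext => x; rewrite [LHS]integralE /fubini_F; congr (_ - _)%E.
  by apply: eq_integral => y _; rewrite !funeposE.
by apply: eq_integral => y _; rewrite !funenegE.
Qed.

Lemma Rint_fubini d1 d2 (T1 : measurableType d1) (T2 : measurableType d2)
    (m1 : {sigma_finite_measure set T1 -> \bar R})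
    (m2 : {sigma_finite_measure set T2 -> \bar R}) (f : T1 * T2 -> R) :
  (m1 \x m2)%E.-integrable setT (EFin \o f) ->
  (forall x, m2.-integrable setT (fun y => (f (x, y))%:E)) ->
  \int[(m1 \x m2)%E]_z f z = \int[m1]_x \int[m2]_y f (x, y).
Proof.
move=> intf intx; rewrite /Rintegral -integral12_prod_meas1//.
congr fine; apply: eq_integral => x _.
by rewrite /fubini_F/= fineK// integrable_fin_num.
Qed.

Lemma Rint_fubini2 d1 d2 (T1 : measurableType d1) (T2 : measurableType d2)
    (m1 : {sigma_finite_measure set T1 -> \bar R})
    (m2 : {sigma_finite_measure set T2 -> \bar R}) (f : T1 * T2 -> R) :
  (m1 \x m2)%E.-integrable setT (EFin \o f) ->
  (forall y, m1.-integrable setT (fun x => (f (x, y))%:E)) ->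
  \int[(m1 \x m2)%E]_z f z = \int[m2]_y \int[m1]_x f (x, y).
Proof.
move=> intf intx; rewrite /Rintegral -integral21_prod_meas1//.
congr fine; apply: eq_integral => x _.
by rewrite /fubini_G/= fineK// integrable_fin_num.
Qed.

Lemma integrableRZl d (T : measurableType d) (mu : {measure set T -> \bar R})
    (k : R) (f : T -> R) : mu.-integrable setT (EFin \o f) ->
  mu.-integrable setT (EFin \o (fun x => k * f x)).
Proof.
move=> /(integrableZl measurableT k); apply: eq_integrable => //.
Qed.

Lemma integrableRZr d (T : measurableType d) (mu : {measure set T -> \bar R})
    (k : R) (f : T -> R) : mu.-integrable setT (EFin \o f) ->
  mu.-integrable setT (EFin \o (fun x => f x * k)).
Proof.
move=> /(integrableZr measurableT k); apply: eq_integrable => //.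
Qed.

Lemma integrableRD d (T : measurableType d) (mu : {measure set T -> \bar R})
    (f g : T -> R) : mu.-integrable setT (EFin \o f) ->
  mu.-integrable setT (EFin \o g) ->
  mu.-integrable setT (EFin \o (fun x => f x + g x)).
Proof.
move=> If Ig; have := integrableD measurableT If Ig; apply: eq_integrable => //.
Qed.

Lemma integrable_le d (T : measurableType d) (mu : {measure set T -> \bar R})
    (f g : T -> R) :
  measurable_fun setT f -> (forall x, `|f x| <= g x) ->
  mu.-integrable setT (EFin \o g) -> mu.-integrable setT (EFin \o f).
Proof.
move=> mf fg; apply: le_integrable => //; first exact/measurable_EFinP.
by move=> x _ /=; rewrite lee_fin (le_trans (fg x))// ler_norm.
Qed.

Lemma integrable_prod d1 d2 (T1 : measurableType d1) (T2 : measurableType d2)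
    (m1 : {sigma_finite_measure set T1 -> \bar R})
    (m2 : {sigma_finite_measure set T2 -> \bar R})
    (f : T1 * T2 -> R) (p : T1 -> R) (q : T2 -> R) :
  measurable_fun setT f ->
  m1.-integrable setT (EFin \o p) -> m2.-integrable setT (EFin \o q) ->
  (forall x y, `|f (x, y)| <= p x * q y) ->
  (m1 \x m2)%E.-integrable setT (EFin \o f).
Proof.
move=> mf ip iq fpq.
have mp : measurable_fun setT p by apply/measurable_EFinP; exact: measurable_int ip.
have mq : measurable_fun setT q by apply/measurable_EFinP; exact: measurable_int iq.
apply: (@integrable_le _ _ _ _ (fun z => p z.1 * q z.2)) => //.
  by move=> [x y]; exact: fpq.
apply/integrable12ltyP.
  by apply/measurable_EFinP; apply: measurable_funM; apply: measurableT_comp.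
under eq_integral => x _.
  under eq_integral do rewrite /= normrM EFinM.
  rewrite ge0_integralZl//; last by apply/measurable_EFinP; exact: measurableT_comp.
  over.
have [_ Ip] := integrableP _ _ _ ip.
have [_ Iq] := integrableP _ _ _ iq.
rewrite ge0_integralZr//.
- by apply: lte_mul_pinfty => //; [exact: integral_ge0|
    rewrite ge0_fin_numE//; exact: integral_ge0].
- by apply/measurable_EFinP; exact: measurableT_comp.
- exact: integral_ge0.
Qed.

(** Domination by a tensor product makes every section integrable, not only
almost every one, so that Fubini's theorem holds without exceptional sets. *)
Lemma Rint_swap d1 d2 (T1 : measurableType d1) (T2 : measurableType d2)
    (m1 : {sigma_finite_measure set T1 -> \bar R})
    (m2 : {sigma_finite_measure set T2 -> \bar R})
    (f : T1 * T2 -> R) (p : T1 -> R) (q : T2 -> R) :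
  measurable_fun setT f ->
  m1.-integrable setT (EFin \o p) -> m2.-integrable setT (EFin \o q) ->
  (forall x y, `|f (x, y)| <= p x * q y) ->
  \int[m1]_x \int[m2]_y f (x, y) = \int[m2]_y \int[m1]_x f (x, y).
Proof.
move=> mf ip iq fpq.
have intf := integrable_prod mf ip iq fpq.
rewrite -Rint_fubini//; last first.
  move=> x; apply: (@integrable_le _ _ _ (fun y => f (x, y)) (fun y => p x * q y)) => //.
    exact: measurableT_comp.
  exact: integrableRZl.
rewrite Rint_fubini2// => y.
apply: (@integrable_le _ _ _ (fun x => f (x, y)) (fun x => p x * q y)) => //.
  exact: measurableT_comp.
exact: integrableRZr.
Qed.

End real_integrals.

(** * Complex-valued integrals *)

Section complex_integrals.
Context {R : realType}.
Local Notation Re := (@complex.Re R).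
Local Notation Im := (@complex.Im R).

Definition cmeas d (T : measurableType d) (f : T -> R[i]) : Prop :=
  measurable_fun setT (fun x => Re (f x)) /\
  measurable_fun setT (fun x => Im (f x)).

Definition cint d (T : measurableType d) (mu : {measure set T -> \bar R})
    (f : T -> R[i]) : R[i] :=
  (\int[mu]_x Re (f x)) +i* (\int[mu]_x Im (f x)).

Definition cintegrable d (T : measurableType d) (mu : {measure set T -> \bar R})
    (f : T -> R[i]) : Prop :=
  mu.-integrable setT (EFin \o (fun x => Re (f x))) /\
  mu.-integrable setT (EFin \o (fun x => Im (f x))).

Definition energy d (T : measurableType d) (mu : {measure set T -> \bar R})
    (f : T -> R[i]) : \bar R := (\int[mu]_x (sqn (f x))%:E)%E.

Section one_space.
Context d (T : measurableType d).
Implicit Types f g : T -> R[i].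

Lemma cmeasB f g : cmeas f -> cmeas g -> cmeas (fun x => f x - g x).
Proof.
move=> [f1 f2] [g1 g2]; split.
  by under eq_fun do rewrite cReB; exact: measurable_funB.
by under eq_fun do rewrite cImB; exact: measurable_funB.
Qed.

Lemma cmeasD f g : cmeas f -> cmeas g -> cmeas (fun x => f x + g x).
Proof.
move=> [f1 f2] [g1 g2]; split.
  by under eq_fun do rewrite cReD; exact: measurable_funD.
by under eq_fun do rewrite cImD; exact: measurable_funD.
Qed.

Lemma cmeasM f g : cmeas f -> cmeas g -> cmeas (fun x => f x * g x).
Proof.
move=> [f1 f2] [g1 g2]; split.
  under eq_fun do rewrite cReM.
  by apply: measurable_funB; exact: measurable_funM.
under eq_fun do rewrite cImM.
by apply: measurable_funD; exact: measurable_funM.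
Qed.

Lemma cmeas_cst (c : R[i]) : cmeas (fun _ : T => c).
Proof. by split. Qed.

Lemma cmeas_real (a : T -> R) : measurable_fun setT a ->
  cmeas (fun x => (a x)%:C).
Proof. by split. Qed.

Lemma cmeas_expi (a : T -> R) : measurable_fun setT a ->
  cmeas (fun x => expi (a x)).
Proof.
move=> ma; split => /=; apply: measurableT_comp => //.
  by apply: continuous_measurable_fun; exact: continuous_cos.
by apply: continuous_measurable_fun; exact: continuous_sin.
Qed.

Lemma cmeas_if (b : T -> bool) f g : measurable_fun setT b ->
  cmeas f -> cmeas g -> cmeas (fun x => if b x then f x else g x).
Proof.
move=> mb [f1 f2] [g1 g2]; split.
  by under eq_fun do rewrite (fun_if Re); exact: measurable_fun_ifT.
by under eq_fun do rewrite (fun_if Im); exact: measurable_fun_ifT.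
Qed.

Lemma cmeas_comp d' (T' : measurableType d') (f : T' -> R[i]) (g : T -> T') :
  cmeas f -> measurable_fun setT g -> cmeas (f \o g).
Proof.
move=> [f1 f2] mg; split.
  exact: (measurableT_comp f1 mg).
exact: (measurableT_comp f2 mg).
Qed.

Lemma measurable_sqn f : cmeas f -> measurable_fun setT (fun x => sqn (f x)).
Proof. by move=> [f1 f2]; apply: measurable_funD; exact: measurable_funX. Qed.

Lemma measurable_normc f : cmeas f ->
  measurable_fun setT (fun x => Normc.normc (f x)).
Proof.
move=> mf; rewrite (_ : (fun x => _) = (@Num.sqrt R) \o (fun x => sqn (f x))).
  apply: measurableT_comp; last exact: measurable_sqn.
  by apply: continuous_measurable_fun; exact: sqrt_continuous.
by apply/funext => x /=; rewrite -sqnE sqrtr_sqr ger0_norm ?normc_ge0.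
Qed.

Context (mu : {measure set T -> \bar R}).

Lemma cintegrable_le f (g : T -> R) : cmeas f ->
  (forall x, Normc.normc (f x) <= g x) -> mu.-integrable setT (EFin \o g) ->
  cintegrable mu f.
Proof.
move=> [f1 f2] fg ig; split; apply: integrable_le ig => // x.
  exact: le_trans (normr_Re_le _) (fg x).
exact: le_trans (normr_Im_le _) (fg x).
Qed.

Lemma cintZl f (c : R[i]) : cintegrable mu f ->
  cint mu (fun x => c * f x) = c * cint mu f.
Proof.
case: c => a b [f1 f2]; apply: complex_eq; rewrite /cint/=.
  under eq_Rintegral do rewrite cReM.
  by rewrite RintegralB ?RintegralZl//; exact: integrableRZl.
under eq_Rintegral do rewrite cImM.
by rewrite RintegralD ?RintegralZl//; exact: integrableRZl.
Qed.

Lemma cintB f g : cintegrable mu f -> cintegrable mu g ->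
  cint mu (fun x => f x - g x) = cint mu f - cint mu g.
Proof.
move=> [f1 f2] [g1 g2]; apply: complex_eq; rewrite /cint/=.
  by under eq_Rintegral do rewrite cReB; rewrite RintegralB.
by under eq_Rintegral do rewrite cImB; rewrite RintegralB.
Qed.

Lemma eq_cint f g : f =1 g -> cint mu f = cint mu g.
Proof. by move=> /funext ->. Qed.

(** The factor 2 comes from bounding the real and the imaginary parts
separately. *)
Lemma normc_cint_le f (g : T -> R) : cmeas f ->
  (forall x, Normc.normc (f x) <= g x) -> mu.-integrable setT (EFin \o g) ->
  Normc.normc (cint mu f) <= 2 * \int[mu]_x g x.
Proof.
move=> mf fg ig; have [f1 f2] := cintegrable_le mf fg ig.
rewrite (le_trans (normc_le_ReIm _))// mulrDl mul1r /cint/= lerD//.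
  rewrite (le_trans (le_normr_Rintegral _ f1))// le_Rintegral//.
    exact: integrable_norm.
  by move=> x _; exact: le_trans (normr_Re_le _) (fg x).
rewrite (le_trans (le_normr_Rintegral _ f2))// le_Rintegral//.
  exact: integrable_norm.
by move=> x _; exact: le_trans (normr_Im_le _) (fg x).
Qed.

Lemma energy_ge0 f : (0 <= energy mu f)%E.
Proof. by apply: integral_ge0 => x _; rewrite lee_fin sqn_ge0. Qed.

Lemma energyZ f c : cmeas f ->
  energy mu (fun x => c * f x) = ((sqn c)%:E * energy mu f)%E.
Proof.
move=> mf; rewrite /energy; under eq_integral do rewrite sqnM EFinM.
rewrite ge0_integralZl//.
- by apply/measurable_EFinP; exact: measurable_sqn.
- by move=> x _; rewrite lee_fin sqn_ge0.
- by rewrite lee_fin sqn_ge0.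
Qed.

Lemma le_energy f g : cmeas f -> cmeas g ->
  (forall x, sqn (f x) <= sqn (g x)) -> (energy mu f <= energy mu g)%E.
Proof.
move=> mf mg fg; apply: ge0_le_integral => //.
- by move=> x _; rewrite lee_fin sqn_ge0.
- by apply/measurable_EFinP; exact: measurable_sqn.
- by apply/measurable_EFinP; exact: measurable_sqn.
- by move=> x _; rewrite lee_fin.
Qed.

(** The squared form of the triangle inequality, with the loss of a factor 2,
which is enough to see that a difference has finite energy. *)
Lemma energyD_le f g : cmeas f -> cmeas g ->
  (energy mu (fun x => (f x + g x)%R) <= 2%:E * energy mu f + 2%:E * energy mu g)%E.
Proof.
move=> mf mg; rewrite /energy -!ge0_integralZl//; last 4 first.
- by apply/measurable_EFinP; exact: measurable_sqn.
- by move=> x _; rewrite lee_fin sqn_ge0.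
- by apply/measurable_EFinP; exact: measurable_sqn.
- by move=> x _; rewrite lee_fin sqn_ge0.
rewrite -ge0_integralD//; last 4 first.
- by move=> x _; rewrite -EFinM lee_fin mulr_ge0// sqn_ge0.
- by apply/measurable_EFinP; apply: measurable_funM => //; exact: measurable_sqn.
- by move=> x _; rewrite -EFinM lee_fin mulr_ge0// sqn_ge0.
- by apply/measurable_EFinP; apply: measurable_funM => //; exact: measurable_sqn.
apply: ge0_le_integral => //.
- by move=> x _; rewrite lee_fin sqn_ge0.
- by apply/measurable_EFinP; apply: measurable_sqn; exact: cmeasD.
- apply/measurable_EFinP; apply: measurable_funD; apply: measurable_funM => //;
    exact: measurable_sqn.
- by move=> x _; rewrite -!EFinM -EFinD lee_fin sqnD_le.
Qed.

End one_space.

Lemma cmeas_cint d1 d2 (T1 : measurableType d1) (T2 : measurableType d2)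
    (m2 : {sigma_finite_measure set T2 -> \bar R}) (f : T1 * T2 -> R[i]) :
  cmeas f -> cmeas (fun x => cint m2 (fun y => f (x, y))).
Proof.
move=> [f1 f2]; split.
  exact: (measurable_Rint m2 f1).
exact: (measurable_Rint m2 f2).
Qed.

Lemma cint_fubini2 d1 d2 (T1 : measurableType d1) (T2 : measurableType d2)
    (m1 : {sigma_finite_measure set T1 -> \bar R})
    (m2 : {sigma_finite_measure set T2 -> \bar R}) (f : T1 * T2 -> R[i])
    (p : T1 -> R) (q : T2 -> R) :
  cmeas f ->
  m1.-integrable setT (EFin \o p) -> m2.-integrable setT (EFin \o q) ->
  (forall x y, Normc.normc (f (x, y)) <= p x * q y) ->
  cint (m1 \x m2)%E f = cint m2 (fun y => cint m1 (fun x => f (x, y))).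
Proof.
move=> [f1 f2] ip iq fpq; apply: complex_eq; rewrite /cint/=.
  have g x y : `|Re (f (x, y))| <= p x * q y.
    exact: le_trans (normr_Re_le _) (fpq x y).
  apply: (@Rint_fubini2 _ _ _ _ _ m1 m2 (fun z => Re (f z))).
    exact: (integrable_prod f1 ip iq g).
  move=> y; apply: (@integrable_le _ _ _ _ (fun x => Re (f (x, y)))
    (fun x => p x * q y)) => //.
    exact: (measurableT_comp f1).
  exact: integrableRZr.
have g x y : `|Im (f (x, y))| <= p x * q y.
  exact: le_trans (normr_Im_le _) (fpq x y).
apply: (@Rint_fubini2 _ _ _ _ _ m1 m2 (fun z => Im (f z))).
  exact: (integrable_prod f2 ip iq g).
move=> y; apply: (@integrable_le _ _ _ _ (fun x => Im (f (x, y)))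
  (fun x => p x * q y)) => //.
  exact: (measurableT_comp f2).
exact: integrableRZr.
Qed.

End complex_integrals.

(** * Abel summation and changes of variable on the line *)

Section one_dim_tools.
Context {R : realType}.
Local Notation lam := (@lebesgue_measure R).

(** The coefficients of sine and cosine solve the linear system that
differentiation of exp (- e y) (A sin (z y) + B cos (z y)) imposes. *)
Lemma abel_antiderivative (e z x : R) : 0 < e ->
  is_derive x 1 (fun y => expR (- e * y) *
      (z / (e ^+ 2 + z ^+ 2) * sin (z * y) +
       - e / (e ^+ 2 + z ^+ 2) * cos (z * y) - e^-1))
    (expR (- e * x) * (1 + cos (z * x))).
Proof.
move=> e0.
have d0 : e ^+ 2 + z ^+ 2 != 0 by rewrite gt_eqF// ltr_wpDr ?sqr_ge0 ?exprn_gt0.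
have dl (k : R) : is_derive x 1 (fun y => k * y) k.
  have H := @is_deriveZ R _ _ id k x 1 1 (is_derive_id x 1).
  by rewrite /GRing.scale/= mulr1 in H.
have dE : is_derive x 1 (fun y => expR (- e * y)) (- e * expR (- e * x)).
  rewrite mulrC; exact: (is_derive1_comp (is_derive_expR _) (dl _)).
have dS : is_derive x 1 (fun y => sin (z * y)) (z * cos (z * x)).
  rewrite mulrC; exact: (is_derive1_comp (is_derive_sin _) (dl _)).
have dC : is_derive x 1 (fun y => cos (z * y)) (- (z * sin (z * x))).
  rewrite mulrC -mulNr; exact: (is_derive1_comp (is_derive_cos _) (dl _)).
apply: is_derive_eq.
rewrite /GRing.scale/=.
by field; rewrite d0 gt_eqF.
Qed.

Lemma cvg_expRM (e : R) : 0 < e -> expR (- e * x) @[x --> +oo] --> 0.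
Proof.
move=> e0; rewrite (_ : (fun x => _) = (fun z => expR (- z)) \o (fun z => e * z)).
  apply: (@cvg_comp _ _ _ _ _ _ (pinfty_nbhs R)); last exact: cvgr_expR.
  exact: gt0_cvgMry.
by apply: eq_fun => x; rewrite mulNr.
Qed.

(** Adding 1 to the cosine makes the integrand nonnegative: the improper
integral is then given by the limit of a primitive before anything is known
about integrability, and integrability of the weight is a consequence. *)
Lemma abel_integral1 (e z : R) : 0 < e ->
  (\int[lam]_(x in `[0%R, +oo[) (expR (- e * x) * (1 + cos (z * x)))%:E =
   (e^-1 + e / (e ^+ 2 + z ^+ 2))%:E)%E.
Proof.
move=> e0.
pose F y := expR (- e * y) *
      (z / (e ^+ 2 + z ^+ 2) * sin (z * y) +
       - e / (e ^+ 2 + z ^+ 2) * cos (z * y) - e^-1).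
have dF (x : R) : is_derive x 1 F (expR (- e * x) * (1 + cos (z * x))).
  exact: abel_antiderivative.
have cF : continuous F.
  by move=> x; apply/differentiable_continuous/derivable1_diffP; exact: ex_derive.
rewrite (@ge0_continuous_FTC2y _ _ F _ 0).
- rewrite -EFinB; congr EFin; rewrite /F !mulr0 sin0 cos0 expR0 mulr0 mulr1.
  by rewrite mulNr; ring.
- by move=> x _; rewrite mulr_ge0 ?expR_ge0// -lerBlDl sub0r cos_geN1.
- apply: continuous_subspaceT => x; apply: cvgM.
    apply: continuous_comp; last exact: continuous_expR.
    exact: mulrl_continuous.
  apply: cvgD; first exact: cvg_cst.
  apply: continuous_comp; last exact: continuous_cos.
  exact: mulrl_continuous.
- pose M := `|z / (e ^+ 2 + z ^+ 2)| + `|- e / (e ^+ 2 + z ^+ 2)| + e^-1.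
  apply: (@squeeze_cvgr _ _ _ _ (fun x => - (M * expR (- e * x)))
      (fun x => M * expR (- e * x))).
  + near=> x; rewrite -ler_norml /F normrM ger0_norm ?expR_ge0// mulrC.
    rewrite ler_wpM2r ?expR_ge0// /M (le_trans (ler_normB _ _))// lerD//.
      rewrite (le_trans (ler_normD _ _))// lerD// normrM ler_piMr//.
        by rewrite ler_norml sin_geN1 sin_le1.
      by rewrite ler_norml cos_geN1 cos_le1.
    by rewrite ger0_norm// invr_ge0 ltW.
  + rewrite -oppr0 -(mulr0 M); apply: cvgN; apply: cvgM; first exact: cvg_cst.
    exact: cvg_expRM.
  + rewrite -(mulr0 M); apply: cvgM; first exact: cvg_cst.
    exact: cvg_expRM.
- by move=> x _; exact: ex_derive.
- exact/cvg_at_right_filter/cF.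
- by move=> x _; rewrite derive1E; exact: derive_val.
Unshelve. all: by end_near. Qed.

(** The Abel weight: the exponential cut-off of the half-line of nonnegative
frequencies, which increases to the indicator function as [e] tends to 0. *)
Definition abelw (e x : R) : R := expR (- e * x) * \1_`[0, +oo[%classic x.

Lemma abelw_ge0 e x : 0 <= abelw e x.
Proof. by rewrite mulr_ge0 ?expR_ge0. Qed.

Lemma measurable_abelw e : measurable_fun setT (abelw e).
Proof.
apply: measurable_funM => //.
apply: measurableT_comp; first exact: measurable_expR.
exact: mulrl_measurable.
Qed.

(** The case z = 0 of the integral of exp (- e x) (1 + cos (z x)), where the
integrand is twice the weight. *)
Lemma integrable_abelw e : 0 < e -> lam.-integrable setT (EFin \o abelw e).
Proof.
move=> e0; apply/integrableP; split.
  by apply/measurable_EFinP; exact: measurable_abelw.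
have := @abel_integral1 e 0 e0; rewrite integral_mkcond/=.
under eq_integral.
  move=> x _.
  rewrite (_ : _ x = (2 * abelw e x)%:E); last first.
    rewrite restrict_EFin/= patchE /abelw indicE; case: ifPn => _.
      by rewrite mul0r cos0 mulr1 mulrC.
    by rewrite !mulr0.
  rewrite EFinM; over.
rewrite ge0_integralZl//; last 2 first.
- by apply/measurable_EFinP; exact: measurable_abelw.
- by move=> x _; rewrite lee_fin abelw_ge0.
move=> h; under eq_integral => x _ do rewrite /= ger0_norm ?abelw_ge0//.
rewrite ltey; apply/eqP => h2; move: h; rewrite [X in (_ * X)%E]h2.
by rewrite gt0_muley.
Qed.

Lemma integrable_abelw_cos e t : 0 < e ->
  lam.-integrable setT (EFin \o (fun x => abelw e x * cos (t * x))).
Proof.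
move=> e0.
apply: (@integrable_le _ _ _ lam _ (abelw e)).
- apply: measurable_funM; first exact: measurable_abelw.
  apply: measurableT_comp; last exact: mulrl_measurable.
  by apply: continuous_measurable_fun; exact: continuous_cos.
- move=> x; rewrite normrM ger0_norm ?abelw_ge0// ler_piMr ?abelw_ge0//.
  by rewrite ler_norml cos_geN1 cos_le1.
- exact: integrable_abelw.
Qed.

(** The transform of the Abel weight is the Poisson kernel.  The case z = 0 of
the integral of exp (- e x) (1 + cos (z x)) is twice the mass of the weight;
half of it is subtracted from the general case. *)
Lemma Rint_abelw e z : 0 < e ->
  \int[lam]_x (abelw e x * cos (z * x)) = e / (e ^+ 2 + z ^+ 2).
Proof.
move=> e0.
have h (t : R) : \int[lam]_x (abelw e x + abelw e x * cos (t * x)) =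
    e^-1 + e / (e ^+ 2 + t ^+ 2).
  rewrite -[RHS]/(fine (_%:E)) -abel_integral1// [in RHS]integral_mkcond.
  congr fine; apply: eq_integral => x _.
  rewrite restrict_EFin/= patchE /abelw indicE; case: ifPn => _.
    by rewrite mulr1 mulrDr mulr1.
  by rewrite !mulr0 mul0r addr0.
have ic := fun t => @integrable_abelw_cos e t e0.
have := h z; rewrite RintegralD//; last exact: integrable_abelw.
have := h 0; rewrite RintegralD//; last exact: integrable_abelw.
under [X in _ + X = _ -> _]eq_Rintegral do rewrite mul0r cos0 mulr1.
rewrite expr0n/= addr0 => h0.
have -> : \int[lam]_x abelw e x = e^-1.
  have : e / e ^+ 2 = e^-1 by field; rewrite gt_eqF.
  by move=> h1; rewrite h1 in h0; lra.
by move/addrI.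
Qed.

(** Folding the line at the origin; useful when only the sum of the values at
opposite points is under control. *)
Lemma integral_fold (f : R -> \bar R) :
  measurable_fun setT f -> (forall x, 0 <= f x)%E ->
  (\int[lam]_x f x =
   \int[lam]_(x in `[0%R, +oo[) (f x + f (- x)%R))%E.
Proof.
move=> mf f0.
have mfN : measurable_fun setT (fun x : R => f (- x)%R).
  by apply: measurableT_comp => //; exact: oppr_measurable.
rewrite ge0_integralD//; last 2 first.
- exact: measurable_funTS.
- exact: measurable_funTS.
rewrite (@ge0_integration_by_substitution0 _ (fun x => f (- x)%R))//.
under [X in (_ + X)%E]eq_integral do rewrite opprK.
rewrite -(@integral_itv_bndo_bndc R _ _ f); last exact: measurable_funTS.
rewrite -ge0_integral_setU//.
- by rewrite setUC (@itv_setU_setT _ _ true 0%R).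
- exact: measurable_funTS.
- by rewrite disj_set2E; apply/eqP/seteqP; split => // x/=; rewrite !in_itv/= andbT => -[]; lra.
Qed.

Lemma Rint_cauchy : lam.-integrable setT (EFin \o (fun w : R => (1 + w ^+ 2)^-1)) /\
  \int[lam]_w (1 + w ^+ 2)^-1 = pi :> R.
Proof.
have mc : measurable_fun setT (fun w : R => (1 + w ^+ 2)^-1).
  apply: continuous_measurable_fun => x; exact: continuous_oneDsqrV.
have h : (\int[lam]_w ((1 + w ^+ 2)^-1)%:E = (pi : R)%:E)%E.
  rewrite integral_fold; last 2 first.
  - exact/measurable_EFinP.
  - by move=> x; rewrite lee_fin invr_ge0 addr_ge0 ?sqr_ge0.
  under eq_integral do rewrite sqrrN.
  rewrite ge0_integralD//; last 4 first.
  - by move=> x; rewrite lee_fin invr_ge0 addr_ge0 ?sqr_ge0.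
  - by apply/measurable_EFinP; exact: measurable_funTS.
  - by move=> x; rewrite lee_fin invr_ge0 addr_ge0 ?sqr_ge0.
  - by apply/measurable_EFinP; exact: measurable_funTS.
  have := @integral0y_oneDsqr R; rewrite /oneDsqr => ->.
  by rewrite -EFinD; congr EFin; lra.
split; last by rewrite /Rintegral h.
apply/integrableP; split; first exact/measurable_EFinP.
under eq_integral => x _ do
  rewrite gee0_abs ?lee_fin ?invr_ge0 ?addr_ge0 ?sqr_ge0//.
by rewrite [ltLHS]h ltry.
Qed.

Definition affine (h c x : R) : measurableTypeR R := h * x + c.

Lemma measurable_affine h c : measurable_fun setT (affine h c).
Proof.
by apply: measurable_funD => //; exact: mulrl_measurable.
Qed.

Definition affine_push h c : {measure set (measurableTypeR R) -> \bar R} :=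
  measure_function_pushforward__canonical__measure_function_Measure
    lam (measurable_affine h c).

(** A measure that takes the right values on half-open intervals is Lebesgue
measure; an affine map sends such intervals to such intervals. *)
Lemma lebesgue_affine (h : {nonneg R}) (c : R) (A : set R) :
  0 < h%:num -> measurable A -> lam A = mscale h (affine_push h%:num c) A.
Proof.
move=> h0; apply: lebesgue_measure_unique => _ [[a b]] _ <-.
rewrite /= /mscale /= /pushforward.
rewrite (_ : affine _ _ @^-1` _ =
    `](a - c) / h%:num, (b - c) / h%:num]%classic); last first.
  apply/seteqP; split => x /=; rewrite !in_itv/= /affine => /andP[].
    by move=> ax xb; rewrite ltr_pdivrMr// ler_pdivlMr//; apply/andP; split; lra.
  by rewrite ltr_pdivrMr// ler_pdivlMr// => ax xb; apply/andP; split; lra.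
rewrite !lebesgue_measure_itv/= !lte_fin ltr_pM2r ?invr_gt0// ltrBlDr subrK.
case: ifPn => _; last by rewrite mule0.
rewrite -!EFinD -EFinM; congr EFin; field.
by rewrite gt_eqF.
Qed.

Lemma ge0_integral_affine (h c : R) (f : R -> \bar R) : 0 < h ->
  measurable_fun setT f -> (forall x, 0 <= f x)%E ->
  (\int[lam]_x f x = h%:E * \int[lam]_x f (h * x + c)%R)%E.
Proof.
move=> h0 mf f0; pose k := NngNum (ltW h0).
rewrite (@eq_measure_integral _ _ _ setT (mscale k (affine_push k%:num c))); last first.
  by move=> A mA _; exact: lebesgue_affine.
rewrite ge0_integral_mscale//; congr (_ * _)%E.
by rewrite ge0_integral_pushforward//; exact: measurable_affine.
Qed.

Lemma integrable_affine (h c : R) (f : R -> R) : 0 < h ->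
  lam.-integrable setT (EFin \o f) ->
  lam.-integrable setT (EFin \o (fun x => f (h * x + c))).
Proof.
move=> h0 /integrableP[/measurable_EFinP mf If]; apply/integrableP; split.
  apply/measurable_EFinP; apply: (measurableT_comp mf).
  exact: (measurable_affine h c).
move: If; rewrite (@ge0_integral_affine h c)//; last first.
  by apply/measurable_EFinP; exact: measurableT_comp.
move=> If; rewrite ltey; apply/eqP => h2; move: If; rewrite [X in (_ * X)%E]h2.
by rewrite gt0_muley.
Qed.

Lemma Rint_affine (h c : R) (f : R -> R) : 0 < h ->
  lam.-integrable setT (EFin \o f) ->
  \int[lam]_x f x = h * \int[lam]_x f (h * x + c).
Proof.
move=> h0 If; have If2 := @integrable_affine h c f h0 If.
have /integrableP[/measurable_EFinP mf _] := If.
rewrite /Rintegral [in LHS]integralE [in RHS]integralE.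
have mp : measurable_fun setT (fun x => (f x)%:E)^\+%E.
  by apply: measurable_funepos; exact/measurable_EFinP.
have mn : measurable_fun setT (fun x => (f x)%:E)^\-%E.
  by apply: measurable_funeneg; exact/measurable_EFinP.
rewrite (@ge0_integral_affine h c _ h0 mp)//.
rewrite (@ge0_integral_affine h c _ h0 mn)//.
have e1 : (\int[lam]_x (fun x => (f (h * x + c))%:E)^\+ x =
   \int[lam]_x (fun x => (f x)%:E)^\+ (h * x + c)%R)%E.
  by apply: eq_integral => x _; rewrite !funeposE.
have e2 : (\int[lam]_x (fun x => (f (h * x + c))%:E)^\- x =
   \int[lam]_x (fun x => (f x)%:E)^\- (h * x + c)%R)%E.
  by apply: eq_integral => x _; rewrite !funenegE.
rewrite -e1 -e2 -muleBr//; first last.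
- rewrite fin_num_adde_defl ?fin_numN//; exact: (integrable_neg_fin_num measurableT If2).
- rewrite fineM// fin_numB (integrable_neg_fin_num measurableT If2).
  by rewrite (integrable_pos_fin_num measurableT If2).
Qed.

End one_dim_tools.

(** * Autocorrelation of a bounded function *)

Section real_line.
Context {R : realType}.
Local Notation lam := (@lebesgue_measure R).

Lemma cvg_shift0 (y : R) (h : R^nat) : h @ \oo --> 0 -> y + h k @[k --> \oo] --> y.
Proof.
move=> h0; have : y + h k @[k --> \oo] --> y + 0.
  by apply: cvgD => //; exact: cvg_cst.
by rewrite addr0.
Qed.

Lemma itv_shift (r x y : R) : `|x| <= r -> `|y| <= 1 -> - (r + 1) <= x + y <= r + 1.
Proof.
rewrite !ler_norml => /andP[x1 x2] /andP[y1 y2].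
by rewrite lerD// andbT opprD lerD.
Qed.

Lemma sum3_le (x y e : R) : 0 <= e -> x <= e -> y <= e -> x + y + x <= 4 * e.
Proof. by move=> *; lra. Qed.

Lemma measurable_cosf d (T : measurableType d) (f : T -> R) :
  measurable_fun setT f -> measurable_fun setT (fun x => cos (f x)).
Proof.
by apply: measurableT_comp; apply: continuous_measurable_fun; exact: continuous_cos.
Qed.

Lemma measurable_sinf d (T : measurableType d) (f : T -> R) :
  measurable_fun setT f -> measurable_fun setT (fun x => sin (f x)).
Proof.
by apply: measurableT_comp; apply: continuous_measurable_fun; exact: continuous_sin.
Qed.

Lemma normr_cos_le1 (x : R) : `|cos x| <= 1.
Proof. by rewrite ler_norml cos_geN1 cos_le1. Qed.

Lemma normr_sin_le1 (x : R) : `|sin x| <= 1.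
Proof. by rewrite ler_norml sin_geN1 sin_le1. Qed.

Lemma integrable_cst_itv (r M : R) :
  lam.-integrable setT (EFin \o (fun x => M * \1_`[- r, r]%classic x)).
Proof. by apply: integrableRZl; exact: integrable_indic_itv. Qed.

Variables (a : R -> R) (M r : R).
Hypothesis ma : measurable_fun setT a.
Hypothesis M0 : 0 <= M.
Hypothesis aM : forall x, `|a x| <= M.
Hypothesis ar : forall x, r < `|x| -> a x = 0.

Lemma bounded_support_le x : `|a x| <= M * \1_`[- r, r]%classic x.
Proof.
rewrite indicE; case: (boolP (x \in _)) => [_|]; first by rewrite mulr1.
rewrite mulr0 => /negP xr; rewrite ar ?normr0// ltNge; apply/negP => xr'.
by apply: xr; rewrite inE/= in_itv/= -ler_norml.
Qed.

Lemma integrable_bounded_support : lam.-integrable setT (EFin \o a).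
Proof. exact: (@integrable_le _ _ _ lam _ _ ma bounded_support_le (integrable_cst_itv r M)). Qed.

Let ia := integrable_bounded_support.
Let ina : lam.-integrable setT (EFin \o (fun x => `|a x|)).
Proof. exact: integrable_norm. Qed.

Definition autocorr (h : R) : R := \int[lam]_y (a y * a (y + h)).

Let ma_shift h : measurable_fun setT (fun y : R => a (y + h)).
Proof. by apply: (measurableT_comp ma); exact: measurable_funD. Qed.

Let int_auto h : lam.-integrable setT (EFin \o (fun y => a y * a (y + h))).
Proof.
apply: (@integrable_le _ _ _ lam _ (fun y => M * `|a y|)).
- have h' : measurable_fun setT (fun y : R => a y * a (y + h)).
    exact: measurable_funM.
  exact: h'.
- by move=> x; rewrite normrM mulrC ler_wpM2r.
- exact: integrableRZl.
Qed.

Lemma autocorr_le h : `|autocorr h| <= M * \int[lam]_y `|a y|.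
Proof.
rewrite (le_trans (le_normr_Rintegral _ (int_auto h)))//.
rewrite -RintegralZl//; apply: le_Rintegral => //.
- by apply: integrable_norm; exact: int_auto.
- exact: integrableRZl.
- by move=> x _; rewrite normrM mulrC ler_wpM2r.
Qed.

(** Translations are continuous in the mean.  On a segment [a] is close in L1
to a continuous function g; the translates of g converge by dominated
convergence, and the error is controlled because the other factor of the
autocorrelation is bounded. *)
Lemma autocorr_cvg (h : R^nat) : h @ \oo --> 0 ->
  autocorr (h k) @[k --> \oo] --> autocorr 0.
Proof.
move=> h0.
(* The segment exceeds the support by 1, in order to contain its translates by
   any h with |h| <= 1 as well. *)
pose E : set (measurableTypeR R) := `[- (r + 1), r + 1]%classic.
have mE : measurable E by exact: measurable_itv.
have iaE : lam.-integrable E (EFin \o a) by exact: integrableS ia.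
have [g_ [cg ig cvg_g]] : exists g_ : (R -> R)^nat,
    [/\ forall n, continuous (g_ n),
        forall n, lam.-integrable E (EFin \o g_ n) &
        (\int[lam]_(z in E) `|(a z - g_ n z)%:E| @[n --> \oo] --> 0)%E].
  apply: approximation_continuous_integrable => //.
  by apply: compact_finite_measure; exact: segment_compact.
pose D n x := `|a x - g_ n x| * \1_E x.
have mD n : measurable_fun setT (D n).
  apply: measurable_funM => //; apply: measurableT_comp => //.
  apply: measurable_funB => //.
  by apply: continuous_measurable_fun; exact: cg.
have D0 n x : 0 <= D n x by rewrite mulr_ge0.
have DE n : (\int[lam]_x (D n x)%:E = \int[lam]_(z in E) `|(a z - g_ n z)%:E|)%E.
  rewrite [RHS]integral_mkcond; apply: eq_integral => x _.
  by rewrite patchE /D indicE; case: ifP; rewrite ?mulr1 ?mulr0.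
have iD n : lam.-integrable setT (EFin \o D n).
  apply/integrableP; split; first by apply/measurable_EFinP; exact: mD.
  under eq_integral => x _ do rewrite /= ger0_norm//.
  rewrite [ltLHS]DE.
  have /integrableP[_] : lam.-integrable E (EFin \o (fun z => a z - g_ n z)).
    have := integrableB mE iaE (ig n).
    by apply: eq_integrable.
  by [].
have DR n : \int[lam]_x D n x = fine (\int[lam]_(z in E) `|(a z - g_ n z)%:E|)%E.
  by rewrite /Rintegral DE.
have cvgD : \int[lam]_x D n x @[n --> \oo] --> 0.
  under eq_fun do rewrite DR.
  by apply: fine_cvg; exact: cvg_g.
apply/cvgrPdist_le => e e0.
(* Three errors of size eta occur, each multiplied by M; M + 1 avoids a
   division by 0. *)
pose eta := e / (4 * (M + 1)).
have eta0 : 0 < eta by rewrite divr_gt0// mulr_gt0// ltr_wpDl.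
have [n Dn] : exists n, \int[lam]_x D n x <= eta.
  move/cvgrPdist_le : cvgD => /(_ _ eta0) [N _ /(_ N (leqnn N))].
  rewrite /= sub0r normrN => h1; exists N; exact: le_trans (ler_norm _) h1.
have [B gB] : exists B, forall x, E x -> `|g_ n x| <= B.
  have [r1|r1] := leP (- (r + 1)) (r + 1); last first.
    exists 0 => x; rewrite /E/= in_itv/= => /andP[h1 h2].
    by move: (le_trans h1 h2); rewrite leNgt r1.
  have : {within E, continuous (fun x => `|g_ n x|)}.
    apply: continuous_subspaceT => x.
    by apply: continuous_comp; [exact: cg|exact: norm_continuous].
  by move=> /(EVT_max r1)[c _ hc]; exists `|g_ n c| => x Ex; apply: hc.
pose m k y := `|g_ n (y + h k) - g_ n y| * \1_`[- r, r]%classic y.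
have mm k : measurable_fun setT (m k).
  apply: measurable_funM => //; apply: measurableT_comp => //.
  have mg : measurable_fun setT (g_ n) by apply: continuous_measurable_fun; exact: cg.
  apply: measurable_funB => //; apply: (measurableT_comp mg).
  exact: measurable_funD.
have hk1 : \forall k \near \oo, `|h k| <= 1.
  move/cvgrPdist_le : h0 => /(_ _ ltr01); apply: filterS => k.
  by rewrite sub0r normrN.
have mB k y : `|h k| <= 1 -> `|m k y| <= 2 * B * \1_`[- r, r]%classic y.
  move=> hk; rewrite /m normrM normr_id [`|\1__ _|]ger0_norm// indicE.
  case: (boolP (y \in _)) => [|_]; last by rewrite !mulr0.
  rewrite inE/= in_itv/= !mulr1 => /andP[y1 y2].
  rewrite (le_trans (ler_normB _ _))// mulrDl mul1r lerD//; apply: gB.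
    rewrite /E/= in_itv/=; move: hk; rewrite ler_norml => /andP[h1 h2].
    by apply/andP; split; lra.
  by rewrite /E/= in_itv/=; apply/andP; split; lra.
have [N1 _ hN1] := hk1.
have im k : (N1 <= k)%N -> lam.-integrable setT (EFin \o m k).
  move=> N1k; apply: (@integrable_le _ _ _ lam _ _ (mm k) _
    (integrable_cst_itv r (2 * B))).
  by move=> y; apply: mB; exact: hN1.
have cvg_m (y : R) : m k y @[k --> \oo] --> (0 : R).
  have hy := @cvg_shift0 y h h0.
  have h1 : g_ n (y + h k) - g_ n y @[k --> \oo] --> (0 : R).
    rewrite -(subrr (g_ n y)); apply: cvgB; last exact: cvg_cst.
    exact: (cvg_comp _ _ hy (cg n y)).
  have h2 : m k y @[k --> \oo] --> `|0 : R| * \1_`[- r, r]%classic y.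
    by apply: cvgM; [exact: cvg_norm|exact: cvg_cst].
  by rewrite normr0 mul0r in h2.
(* The domination requires |h k| <= 1, whence the shift of the indices. *)
have cm : \int[lam]_y m (k + N1)%N y @[k --> \oo] --> 0.
  have [] := @dominated_convergence _ _ _ lam setT measurableT
    (fun k y => (m (k + N1)%N y)%:E) (cst 0%E)
    (EFin \o (fun y => 2 * B * \1_`[- r, r]%classic y)).
  - by move=> k; apply/measurable_EFinP; exact: mm.
  - exact: measurable_cst.
  - apply: aeW => y _; apply/cvg_EFin; first exact: nearW.
    rewrite /comp/=.
    by rewrite (cvg_shiftn N1 (fun k => m k y)); exact: cvg_m.
  - exact: integrable_cst_itv.
  - apply: aeW => y k _ /=; rewrite lee_fin; apply: mB; apply: hN1 => /=.
    exact: leq_addl.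
  by move=> _ _; rewrite integral0 => hc; exact: (fine_cvg hc).
have mI k : 0 <= \int[lam]_y m k y.
  by apply: Rintegral_ge0 => y _; rewrite mulr_ge0.
have : \forall k \near \oo, \int[lam]_y m k y <= eta.
  have := cm; rewrite (cvg_shiftn N1 (fun k => \int[lam]_y m k y)).
  move/cvgrPdist_le => /(_ _ eta0); apply: filterS => k.
  by rewrite sub0r normrN ger0_norm.
move=> meta.
near=> k.
have hk : `|h k| <= 1 by near: k.
have N1k : (N1 <= k)%N by near: k; exists N1.
have shiftD : \int[lam]_y D n (y + h k) = \int[lam]_y D n y.
  rewrite [RHS](@Rint_affine R 1 (h k))// mul1r.
  by apply: eq_Rintegral => y _; rewrite mul1r.
have iDs : lam.-integrable setT (EFin \o (fun y => D n (y + h k))).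
  have := @integrable_affine R 1 (h k) _ ltr01 (iD n).
  by apply: eq_integrable => // y _ /=; rewrite mul1r.
have key y : `|a y * a y - a y * a (y + h k)| <=
    M * (D n (y + h k) + m k y + D n y).
  rewrite -mulrBr normrM.
  have [yr|yr] := ltP r `|y|.
    by rewrite ar// normr0 mul0r mulr_ge0// !addr_ge0// mulr_ge0.
  rewrite ler_pM// /D /m.
  have yr' : y \in `[- r, r]%classic by rewrite inE/= in_itv/= -ler_norml.
  have y3 : - (r + 1) <= y <= r + 1.
    by have := itv_shift yr (y := 0); rewrite addr0 normr0; apply.
  have y4 := itv_shift yr hk.
  have yE : y \in E by rewrite /E inE/= in_itv.
  have yhE : y + h k \in E by rewrite /E inE/= in_itv.
  rewrite !indicE yr' yE yhE !mulr1.
  rewrite (_ : a y - a (y + h k) = (- (a (y + h k) - g_ n (y + h k))) +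
    (- (g_ n (y + h k) - g_ n y)) + (a y - g_ n y)); last by ring.
  rewrite (le_trans (ler_normD _ _))// lerD2r.
  by rewrite (le_trans (ler_normD _ _))// !normrN.
rewrite /autocorr; under eq_Rintegral do rewrite addr0.
have iaa : lam.-integrable setT (EFin \o (fun y => a y * a y)).
  by have := int_auto 0; apply: eq_integrable => // y _; rewrite /= addr0.
rewrite -RintegralB//.
have iaB : lam.-integrable setT (EFin \o (fun y => a y * a y - a y * a (y + h k))).
  have := integrableB measurableT iaa (int_auto (h k)).
  by apply: eq_integrable.
have i3 : lam.-integrable setT (EFin \o (fun y => D n (y + h k) + m k y + D n y)).
  by apply: integrableRD => //; apply: integrableRD => //; exact: im.
rewrite (le_trans (le_normr_Rintegral _ iaB))//.
apply: (@le_trans _ _ (\int[lam]_y (M * (D n (y + h k) + m k y + D n y)))).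
  apply: le_Rintegral => //.
  - exact: integrable_norm.
  - exact: integrableRZl.
rewrite RintegralZl// RintegralD//; last by apply: integrableRD => //; exact: im.
rewrite RintegralD//; last exact: im.
rewrite shiftD.
have mk : \int[lam]_y m k y <= eta by near: k.
have : M * (\int[lam]_y D n y + \int[lam]_y m k y + \int[lam]_y D n y) <=
  (M + 1) * (4 * eta).
  apply: ler_pM => //; first by rewrite !addr_ge0// Rintegral_ge0.
    by rewrite lerDl.
  exact: (sum3_le (ltW eta0)).
move=> /le_trans; apply.
rewrite /eta le_eqVlt; apply/orP; left; apply/eqP; field.
by rewrite gt_eqF// ltr_wpDl.
Unshelve. all: by end_near. Qed.

End real_line.

(** * Plancherel identity for real functions on the line *)

Section real_plancherel.
Context {R : realType}.

Lemma poisson_le (e t : R) : 0 < e -> e / (e ^+ 2 + t ^+ 2) <= e^-1.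
Proof.
move=> e0; have e2 : 0 < e ^+ 2 by rewrite exprn_gt0.
rewrite ler_pdivrMr; last by rewrite ltr_wpDr ?sqr_ge0.
rewrite mulrDr expr2 mulKf ?gt_eqF// lerDl mulr_ge0 ?sqr_ge0// invr_ge0 ltW//.
Qed.

Local Notation lam := (@lebesgue_measure R).

Variables (a : R -> R) (M r : R).
Hypothesis ma : measurable_fun setT a.
Hypothesis M0 : 0 <= M.
Hypothesis aM : forall x, `|a x| <= M.
Hypothesis ar : forall x, r < `|x| -> a x = 0.

Let ia : lam.-integrable setT (EFin \o a).
Proof. exact: (integrable_bounded_support ma aM ar). Qed.

Let ina : lam.-integrable setT (EFin \o (fun x => `|a x|)).
Proof. exact: integrable_norm. Qed.

Definition cosT (xi : R) : R := \int[lam]_x (a x * cos (x * xi)).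
Definition sinT (xi : R) : R := \int[lam]_x (a x * sin (x * xi)).

Let L := \int[lam]_x `|a x|.

Let macos : measurable_fun setT (fun z : R * R => a z.2 * cos (z.2 * z.1)).
Proof.
apply: measurable_funM; first exact: (measurableT_comp ma).
by apply: measurable_cosf; exact: measurable_funM.
Qed.

Let masin : measurable_fun setT (fun z : R * R => a z.2 * sin (z.2 * z.1)).
Proof.
apply: measurable_funM; first exact: (measurableT_comp ma).
by apply: measurable_sinf; exact: measurable_funM.
Qed.

Lemma measurable_cosT : measurable_fun setT cosT.
Proof. exact: (measurable_Rint lam macos). Qed.

Lemma measurable_sinT : measurable_fun setT sinT.
Proof. exact: (measurable_Rint lam masin). Qed.

Lemma integrable_cosT xi : lam.-integrable setT (EFin \o (fun x => a x * cos (x * xi))).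
Proof.
apply: (@integrable_le _ _ _ lam _ _ _ _ ina).
  have h : measurable_fun setT (fun x : R => a x * cos (x * xi)).
    by apply: measurable_funM => //; apply: measurable_cosf; exact: mulrr_measurable.
  exact: h.
by move=> x; rewrite normrM ler_piMr// normr_cos_le1.
Qed.

Lemma integrable_sinT xi : lam.-integrable setT (EFin \o (fun x => a x * sin (x * xi))).
Proof.
apply: (@integrable_le _ _ _ lam _ _ _ _ ina).
  have h : measurable_fun setT (fun x : R => a x * sin (x * xi)).
    by apply: measurable_funM => //; apply: measurable_sinf; exact: mulrr_measurable.
  exact: h.
by move=> x; rewrite normrM ler_piMr// normr_sin_le1.
Qed.

Lemma normr_cosT_le xi : `|cosT xi| <= L.
Proof.
rewrite (le_trans (le_normr_Rintegral _ (integrable_cosT xi)))//.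
apply: le_Rintegral => //.
- by apply: integrable_norm; exact: integrable_cosT.
- by move=> x _; rewrite normrM ler_piMr// normr_cos_le1.
Qed.

Lemma normr_sinT_le xi : `|sinT xi| <= L.
Proof.
rewrite (le_trans (le_normr_Rintegral _ (integrable_sinT xi)))//.
apply: le_Rintegral => //.
- by apply: integrable_norm; exact: integrable_sinT.
- by move=> x _; rewrite normrM ler_piMr// normr_sin_le1.
Qed.

(** The squared modulus of the Fourier transform of the real function [a]. *)
Definition powT (xi : R) : R := cosT xi ^+ 2 + sinT xi ^+ 2.

Lemma measurable_powT : measurable_fun setT powT.
Proof.
by apply: measurable_funD; apply: measurable_funX;
  [exact: measurable_cosT|exact: measurable_sinT].
Qed.

Let f1 (e : R) (z : R * R) : R :=
  abelw e z.1 * (a z.2 * (cos (z.2 * z.1) * cosT z.1 + sin (z.2 * z.1) * sinT z.1)).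

Let mf1 e : measurable_fun setT (f1 e).
Proof.
apply: measurable_funM.
  by apply: (measurableT_comp (measurable_abelw e)).
apply: measurable_funM; first exact: (measurableT_comp ma).
apply: measurable_funD; apply: measurable_funM.
- by apply: measurable_cosf; exact: measurable_funM.
- exact: (measurableT_comp measurable_cosT).
- by apply: measurable_sinf; exact: measurable_funM.
- exact: (measurableT_comp measurable_sinT).
Qed.

Let f1_le e x y : `|f1 e (x, y)| <= abelw e x * (`|a y| * (2 * L)).
Proof.
rewrite /f1/= normrM [`|abelw _ _|]ger0_norm ?abelw_ge0// ler_wpM2l ?abelw_ge0//.
rewrite normrM ler_wpM2l// (le_trans (ler_normD _ _))// mulrDl mul1r lerD// normrM.
  by rewrite -[leRHS]mul1r ler_pM// ?normr_cos_le1// normr_cosT_le.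
by rewrite -[leRHS]mul1r ler_pM// ?normr_sin_le1// normr_sinT_le.
Qed.

Let f1_sum e xi : abelw e xi * powT xi = \int[lam]_y f1 e (xi, y).
Proof.
have ic := integrable_cosT xi; have is_ := integrable_sinT xi.
rewrite /f1/= RintegralZl//; last first.
  have := integrableRD (integrableRZr (cosT xi) ic) (integrableRZr (sinT xi) is_).
  by apply: eq_integrable => // y _ /=; congr EFin; ring.
congr (_ * _); transitivity (\int[lam]_x (a x * cos (x * xi) * cosT xi) +
  \int[lam]_x (a x * sin (x * xi) * sinT xi)).
  by rewrite !RintegralZr.
rewrite -RintegralD//; try exact: integrableRZr.
by apply: eq_Rintegral => y _; ring.
Qed.

Let f2 (e y : R) (z : R * R) : R :=
  abelw e z.1 * (a y * (a z.2 * cos ((z.2 - y) * z.1))).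

Let mf2 e y : measurable_fun setT (f2 e y).
Proof.
apply: measurable_funM.
  by apply: (measurableT_comp (measurable_abelw e)).
apply: measurable_funM => //; apply: measurable_funM.
  exact: (measurableT_comp ma).
by apply: measurable_cosf; apply: measurable_funM => //; exact: measurable_funB.
Qed.

Let f2_le e y x x' : `|f2 e y (x, x')| <= abelw e x * (M * `|a x'|).
Proof.
rewrite /f2/= normrM [`|abelw _ _|]ger0_norm ?abelw_ge0// ler_wpM2l ?abelw_ge0//.
by rewrite !normrM ler_pM// ler_piMr// normr_cos_le1.
Qed.

Let f2_sum e xi y : f1 e (xi, y) = \int[lam]_x f2 e y (xi, x).
Proof.
have ic := integrable_cosT xi; have is_ := integrable_sinT xi.
have E x : f2 e y (xi, x) = abelw e xi * a y *
    (a x * cos (x * xi) * cos (y * xi) + a x * sin (x * xi) * sin (y * xi)).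
  by rewrite /f2/= mulrBl cosB; ring.
under eq_Rintegral do rewrite E.
rewrite RintegralZl//; last first.
  by apply: integrableRD; exact: integrableRZr.
rewrite RintegralD//; try exact: integrableRZr.
rewrite !RintegralZr// /f1/= -/(cosT xi) -/(sinT xi); ring.
Qed.

Let f2_int e (x y : R) : 0 < e ->
  \int[lam]_t f2 e y (t, x) = a y * (a x * (e / (e ^+ 2 + (x - y) ^+ 2))).
Proof.
move=> e0.
transitivity (\int[lam]_t (a y * a x * (abelw e t * cos ((x - y) * t)))).
  by apply: eq_Rintegral => t _; rewrite /f2/=; ring.
rewrite RintegralZl//; first by rewrite Rint_abelw// mulrA.
exact: integrable_abelw_cos.
Qed.

(** Expanding the two squares gives cos (x xi) cos (y xi) + sin (x xi) sin (y xi),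
which is cos ((x - y) xi).  The integral in xi is then that of the Abel weight
against a cosine; the two exchanges of integrals are legitimate thanks to the
weight. *)
Let abel_swap e : 0 < e -> \int[lam]_xi (abelw e xi * powT xi) =
  \int[lam]_y \int[lam]_x (a y * (a x * (e / (e ^+ 2 + (x - y) ^+ 2)))).
Proof.
move=> e0.
under eq_Rintegral do rewrite f1_sum.
rewrite (@Rint_swap _ _ _ _ _ lam lam (f1 e) (abelw e) (fun y => `|a y| * (2 * L)))//.
- apply: eq_Rintegral => y _.
  under eq_Rintegral do rewrite f2_sum.
  rewrite (@Rint_swap _ _ _ _ _ lam lam (f2 e y) (abelw e) (fun y => M * `|a y|))//.
  + by apply: eq_Rintegral => x _; exact: f2_int.
  + exact: mf2.
  + exact: integrable_abelw.
  + exact: integrableRZl.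
- exact: mf1.
- exact: integrable_abelw.
- exact: integrableRZr.
Qed.

Let f3 (e : R) (z : R * R) : R := a z.1 * a (e * z.2 + z.1) * (1 + z.2 ^+ 2)^-1.

(** The substitution x = e w + y turns the Poisson kernel into the density
1 / (1 + w^2), which does not depend on e. *)
Let poisson_affine e (y : R) : 0 < e ->
  \int[lam]_x (a y * (a x * (e / (e ^+ 2 + (x - y) ^+ 2)))) =
  \int[lam]_w f3 e (y, w).
Proof.
move=> e0.
pose F x : R := a y * (a x * (e / (e ^+ 2 + (x - y) ^+ 2))).
have d0 (x : R) : 0 < e ^+ 2 + (x - y) ^+ 2 by rewrite ltr_wpDr ?sqr_ge0 ?exprn_gt0.
have mF : measurable_fun setT F.
  apply: measurable_funM => //; apply: measurable_funM => //.
  apply: measurable_funM => //.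
  apply: continuous_measurable_fun => x; apply: cvgV; first by rewrite gt_eqF.
  apply: cvgD; first exact: cvg_cst.
  apply: (@cvg_comp _ _ _ (fun x : R => x - y) (fun x : R => x ^+ 2)); last exact: exprn_continuous.
  by apply: cvgB; [exact: cvg_id|exact: cvg_cst].
have FB x : `|F x| <= M * e^-1 * `|a x|.
  have q0 : 0 <= e / (e ^+ 2 + (x - y) ^+ 2) by rewrite divr_ge0 ?ltW.
  rewrite /F normrM -mulrA ler_pM// normrM [`|e / _|]ger0_norm// mulrC.
  by rewrite ler_wpM2r// poisson_le.
transitivity (\int[lam]_x F x) => //.
rewrite (@Rint_affine R e y F e0); last first.
  exact: (@integrable_le _ _ _ lam _ _ mF FB (integrableRZl _ ina)).
rewrite -RintegralZl//; last first.
  apply: integrable_affine => //.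
  exact: (@integrable_le _ _ _ lam _ _ mF FB (integrableRZl _ ina)).
apply: eq_Rintegral => w _; rewrite /F /f3/= addrK.
rewrite exprMn; field.
by rewrite !gt_eqF// ltr_pwDl// ?exprn_gt0// sqr_ge0.
Qed.

Let mf3 e : measurable_fun setT (f3 e).
Proof.
apply: measurable_funM.
  apply: measurable_funM; first exact: (measurableT_comp ma).
  apply: (measurableT_comp ma); apply: measurable_funD => //.
  exact: measurable_funM.
apply: (@measurableT_comp _ _ _ _ _ _ (fun w : R => (1 + w ^+ 2)^-1)) => //.
by apply: continuous_measurable_fun => x; exact: continuous_oneDsqrV.
Qed.

Let int_fixed (h : R) : lam.-integrable setT (EFin \o (fun y => a y * a (h + y))).
Proof.
have mh : measurable_fun setT (fun y : R => a y * a (h + y)).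
  by apply: measurable_funM => //; apply: (measurableT_comp ma); exact: measurable_funD.
apply: (@integrable_le _ _ _ lam _ _ mh _ (integrableRZl M ina)).
by move=> y; rewrite normrM mulrC ler_wpM2r.
Qed.

Let abel_autocorr e : 0 < e -> \int[lam]_xi (abelw e xi * powT xi) =
  \int[lam]_w (autocorr a (e * w) * (1 + w ^+ 2)^-1).
Proof.
move=> e0; rewrite abel_swap//.
under eq_Rintegral do rewrite poisson_affine//.
rewrite (@Rint_swap _ _ _ _ _ lam lam (f3 e) (fun y => M * `|a y|)
  (fun w => (1 + w ^+ 2)^-1))//; last 4 first.
- exact: mf3.
- exact: integrableRZl.
- by have [] := @Rint_cauchy R.
- move=> x y; rewrite /f3/= normrM [`|_^-1|]ger0_norm ?invr_ge0 ?addr_ge0 ?sqr_ge0//.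
  by rewrite ler_wpM2r ?invr_ge0 ?addr_ge0 ?sqr_ge0// normrM mulrC ler_wpM2r.
apply: eq_Rintegral => w _; rewrite /f3/= /autocorr.
rewrite RintegralZr//.
  by congr (_ * _); apply: eq_Rintegral => y _; rewrite addrC.
Qed.

Lemma measurable_autocorr : measurable_fun setT (autocorr a).
Proof.
have mz : measurable_fun setT (fun z : R * R => a z.2 * a (z.2 + z.1)).
  apply: measurable_funM; first exact: (measurableT_comp ma).
  by apply: (measurableT_comp ma); exact: measurable_funD.
exact: (measurable_Rint lam mz).
Qed.

Let powT_ge0 xi : 0 <= powT xi. Proof. by rewrite addr_ge0 ?sqr_ge0. Qed.

Let integrable_abel_powT e : 0 < e ->
  lam.-integrable setT (EFin \o (fun xi => abelw e xi * powT xi)).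
Proof.
move=> e0; have mp : measurable_fun setT (fun xi : R => abelw e xi * powT xi).
  by apply: measurable_funM; [exact: measurable_abelw|exact: measurable_powT].
apply: (@integrable_le _ _ _ lam _ _ mp _
  (integrableRZr (L ^+ 2 + L ^+ 2) (integrable_abelw e0))).
move=> x; rewrite normrM ger0_norm ?abelw_ge0// ger0_norm//.
rewrite ler_wpM2l ?abelw_ge0// /powT -[cosT x ^+ 2]real_normK ?num_real//.
rewrite -[sinT x ^+ 2]real_normK ?num_real// lerD// lerXn2r ?nnegrE//.
- by apply: Rintegral_ge0.
- exact: normr_cosT_le.
- by apply: Rintegral_ge0.
- exact: normr_sinT_le.
Qed.

Let e_ k : R := k.+1%:R^-1.
Let e_gt0 k : 0 < e_ k. Proof. by rewrite invr_gt0. Qed.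

(** The autocorrelation is bounded and continuous at 0, and 1 / (1 + w^2) is
integrable with integral pi: dominated convergence along e = 1 / (k + 1). *)
Let cvg_autocorr : \int[lam]_xi (abelw (e_ k) xi * powT xi) @[k --> \oo] -->
    autocorr a 0 * pi.
Proof.
under eq_fun do rewrite abel_autocorr//.
have [Ic Ec] := @Rint_cauchy R.
have mc : measurable_fun setT (fun w : R => (1 + w ^+ 2)^-1).
  by apply: continuous_measurable_fun => x; exact: continuous_oneDsqrV.
have m1 k : measurable_fun setT (fun w : R => autocorr a (e_ k * w) * (1 + w ^+ 2)^-1).
  apply: measurable_funM => //.
  by apply: (measurableT_comp measurable_autocorr); exact: mulrl_measurable.
have m2 : measurable_fun setT (fun w : R => autocorr a 0 * (1 + w ^+ 2)^-1).
  exact: measurable_funM.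
have c1 (w : R) : autocorr a (e_ k * w) * (1 + w ^+ 2)^-1 @[k --> \oo] -->
    autocorr a 0 * (1 + w ^+ 2)^-1.
  apply: cvgM; last exact: cvg_cst.
  apply: (autocorr_cvg ma M0 aM ar).
  rewrite -(mul0r w); apply: cvgM; last exact: cvg_cst.
  exact: cvg_harmonic.
have [] := @dominated_convergence _ _ _ lam setT measurableT
  (fun k w => (autocorr a (e_ k * w) * (1 + w ^+ 2)^-1)%:E)
  (fun w => (autocorr a 0 * (1 + w ^+ 2)^-1)%:E)
  (EFin \o (fun w => M * L * (1 + w ^+ 2)^-1)).
- by move=> k; apply/measurable_EFinP; exact: m1.
- by apply/measurable_EFinP; exact: m2.
- apply: aeW => w _; apply/cvg_EFin; first exact: nearW.
  exact: c1.
- exact: (integrableRZl _ Ic).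
- apply: aeW => w k _ /=; rewrite lee_fin normrM [`|_^-1|]ger0_norm;
    last by rewrite invr_ge0 addr_ge0 ?sqr_ge0.
  rewrite ler_wpM2r ?invr_ge0 ?addr_ge0 ?sqr_ge0//.
  exact: (autocorr_le ma aM ar).
move=> Ia _ h.
rewrite -Ec -RintegralZl//.
apply: fine_cvg; rewrite fineK; first exact: h.
exact: integrable_fin_num.
Qed.

(** The weights increase to 1 on the half-line of nonnegative frequencies. *)
Let cvg_powT : (\int[lam]_xi (abelw (e_ k) xi * powT xi)%:E)%E @[k --> \oo] -->
  (\int[lam]_(xi in `[0%R, +oo[) (powT xi)%:E)%E.
Proof.
have lim1 xi : (abelw (e_ k) xi * powT xi)%:E @[k --> \oo] -->
    (((EFin \o powT) \_ `[0%R, +oo[) xi).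
  rewrite restrict_EFin; apply/cvg_EFin; first exact: nearW.
  rewrite patchE /comp/= /abelw indicE; case: ifPn => _; last first.
    by under eq_fun do rewrite mulr0 mul0r; exact: cvg_cst.
  rewrite -[X in _ --> X]mul1r; apply: cvgM; last exact: cvg_cst.
  under eq_fun do rewrite mulr1.
  rewrite -expR0; apply: (@cvg_comp _ _ _ (fun k => - e_ k * xi) expR); last first.
    exact: continuous_expR.
  rewrite -(mul0r xi) -oppr0; apply: cvgM; last exact: cvg_cst.
  by apply: cvgN; exact: cvg_harmonic.
rewrite integral_mkcond.
have -> : (\int[lam]_x ((EFin \o powT) \_ `[0%R, +oo[) x)%E =
    (\int[lam]_x limn (fun k => (abelw (e_ k) x * powT x)%:E))%E.
  by apply: eq_integral => x _; apply/esym/cvg_lim.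
apply: cvg_monotone_convergence => //.
- move=> k; apply/measurable_EFinP; apply: measurable_funM.
    exact: measurable_abelw.
  exact: measurable_powT.
- by move=> k x _; rewrite lee_fin mulr_ge0 ?abelw_ge0.
- move=> x _ k k' kk'; rewrite lee_fin ler_wpM2r// /abelw indicE.
  case: (boolP (x \in _)) => [|_]; last by rewrite !mulr0.
  rewrite inE/= in_itv/= andbT !mulr1 => x0.
  by rewrite ler_expR ler_wpM2r// lerN2 lef_pV2 ?posrE// ler_nat ltnS.
Qed.

(** The two limits of the Abel means of [powT] as the cut-off disappears.  Since
[a] is real, [powT] is even, so the half-line already determines the whole
integral; pi is half of 2 pi. *)
Lemma real_plancherel :
  (\int[lam]_(xi in `[0%R, +oo[) (powT xi)%:E = (pi * \int[lam]_x (a x ^+ 2))%:E)%E.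
Proof.
have -> : pi * \int[lam]_x (a x ^+ 2) = autocorr a 0 * pi.
  by rewrite mulrC; congr (_ * _); apply: eq_Rintegral => x _; rewrite addr0 expr2.
apply: (cvg_unique _ cvg_powT); first exact: ereal_hausdorff.
rewrite (_ : (fun k => _) = EFin \o
    (fun k => \int[lam]_xi (abelw (e_ k) xi * powT xi))).
  by apply/cvg_EFin; [exact: nearW|exact: cvg_autocorr].
apply/funext => k /=; rewrite fineK//.
by apply: integrable_fin_num => //; exact: integrable_abel_powT.
Qed.

End real_plancherel.

(** * Plancherel identity on the line *)

Section complex_line.
Context {R : realType}.
Local Notation lam := (@lebesgue_measure R).
Local Notation Re := (@complex.Re R).
Local Notation Im := (@complex.Im R).

Definition fourier_line (f : R -> R[i]) (xi : R) : R[i] :=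
  cint lam (fun x => expi (- (x * xi)) * f x).

Lemma cosTN (a : R -> R) xi : cosT a (- xi) = cosT a xi.
Proof. by apply: eq_Rintegral => x _; rewrite mulrN cosN. Qed.

Lemma sinTN (a : R -> R) xi :
  lam.-integrable setT (EFin \o (fun x => a x * sin (x * xi))) ->
  sinT a (- xi) = - sinT a xi.
Proof.
move=> is_; rewrite -[RHS]mulN1r /sinT -RintegralZl//.
by apply: eq_Rintegral => x _; rewrite mulrN sinN mulrN mulN1r.
Qed.

(** For f = a + i b the squared modulus at xi contains cross products of the
transforms of a and b.  They change sign with xi, since cosine transforms are
even and sine transforms are odd, and disappear from the integral folded at
the origin. *)
Lemma fourier_line_plancherel (f : R -> R[i]) (M r : R) :
  cmeas f -> (forall x, Normc.normc (f x) <= M) ->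
  (forall x, r < `|x| -> f x = 0) ->
  energy lam (fourier_line f) = ((2 * pi)%:E * energy lam f)%E.
Proof.
move=> mf fM fr; have [ma mb] := mf.
have M0 : 0 <= M by exact: le_trans (normc_ge0 _) (fM 0).
pose a x := Re (f x); pose b x := Im (f x).
have aM x : `|a x| <= M by exact: le_trans (normr_Re_le _) (fM x).
have bM x : `|b x| <= M by exact: le_trans (normr_Im_le _) (fM x).
have ar x : r < `|x| -> a x = 0 by rewrite /a => /fr ->.
have br x : r < `|x| -> b x = 0 by rewrite /b => /fr ->.
have ia := integrable_bounded_support ma aM ar.
have ib := integrable_bounded_support mb bM br.
have ic := integrable_cosT ma aM ar; have is_ := integrable_sinT ma aM ar.
have jc := integrable_cosT mb bM br; have js := integrable_sinT mb bM br.
have ReF xi : Re (fourier_line f xi) = cosT a xi + sinT b xi.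
  rewrite /cosT /sinT -RintegralD//; apply: eq_Rintegral => x _.
  by rewrite cReM /expi/= cosN sinN /a /b; ring.
have ImF xi : Im (fourier_line f xi) = cosT b xi - sinT a xi.
  rewrite /cosT /sinT -RintegralB//; apply: eq_Rintegral => x _.
  by rewrite cImM /expi/= cosN sinN /a /b; ring.
have mF : cmeas (fourier_line f).
  split.
    under eq_fun do rewrite ReF.
    by apply: measurable_funD; [exact: measurable_cosT|exact: measurable_sinT].
  under eq_fun do rewrite ImF.
  by apply: measurable_funB; [exact: measurable_cosT|exact: measurable_sinT].
have sq xi : sqn (fourier_line f xi) + sqn (fourier_line f (- xi)) =
    2 * powT a xi + 2 * powT b xi.
  rewrite /sqn !ReF !ImF !cosTN !sinTN// /powT; ring.
rewrite /energy integral_fold; last 2 first.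
- by apply/measurable_EFinP; exact: measurable_sqn.
- by move=> x; rewrite lee_fin sqn_ge0.
transitivity (\int[lam]_(x in `[0%R, +oo[)
    ((2 * powT a x)%:E + (2 * powT b x)%:E))%E.
  by apply: eq_integral => x _; exact: (congr1 EFin (sq x)).
have p0 (c : R -> R) x : 0 <= 2 * powT c x.
  by rewrite mulr_ge0// /powT addr_ge0 ?sqr_ge0.
have mpa : measurable_fun setT (fun x => 2 * powT a x).
  by apply: measurable_funM => //; exact: measurable_powT.
have mpb : measurable_fun setT (fun x => 2 * powT b x).
  by apply: measurable_funM => //; exact: measurable_powT.
rewrite ge0_integralD//; last 4 first.
- by move=> x _; rewrite lee_fin.
- by apply/measurable_EFinP; exact: measurable_funTS.
- by move=> x _; rewrite lee_fin.
- by apply/measurable_EFinP; exact: measurable_funTS.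
have half (c : R -> R) : measurable_fun setT c -> (forall x, `|c x| <= M) ->
    (forall x, r < `|x| -> c x = 0) ->
    (\int[lam]_(x in `[0%R, +oo[) (2 * powT c x)%:E =
     (2 * pi)%:E * \int[lam]_x (c x ^+ 2)%:E)%E.
  move=> mc cM cr; under eq_integral do rewrite EFinM.
  rewrite ge0_integralZl//; last 2 first.
  - by apply/measurable_EFinP; apply: measurable_funTS; exact: measurable_powT.
  - by move=> x _; rewrite lee_fin /powT addr_ge0 ?sqr_ge0.
  rewrite (real_plancherel mc M0 cM cr) !EFinM -muleA; congr (_ * (_ * _))%E.
  rewrite fineK//; apply: integrable_fin_num => //.
  have mc2 : measurable_fun setT (fun x : R => c x ^+ 2) by exact: measurable_funX.
  apply: (@integrable_le _ _ _ lam _ _ mc2 _ (integrableRZl M (integrable_norm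
    (integrable_bounded_support mc cM cr)))).
  by move=> x; rewrite /= normrX expr2 ler_wpM2r.
rewrite half// half//.
rewrite -ge0_muleDr; last 2 first.
- by apply: integral_ge0 => x _; rewrite lee_fin sqr_ge0.
- by apply: integral_ge0 => x _; rewrite lee_fin sqr_ge0.
congr (_ * _)%E; rewrite -ge0_integralD//.
- by move=> x _; rewrite lee_fin sqr_ge0.
- by apply/measurable_EFinP; exact: measurable_funX.
- by move=> x _; rewrite lee_fin sqr_ge0.
- by apply/measurable_EFinP; exact: measurable_funX.
Qed.

End complex_line.

(** * Coordinates, product measures and boxes *)

Section boxes.
Context {R : realType}.
Local Notation lam := (@lebesgue_measure R).
Local Notation mu := (@rV_lebesgue R).

Lemma rV_cons0 n (p : R * 'rV[R]_n) : (rV_cons p) ord0 ord0 = p.1.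
Proof. by have /(congr1 fst) := rV_consK p. Qed.

Lemma rV_consS n (p : R * 'rV[R]_n) (i : 'I_n) :
  (rV_cons p) ord0 (lift ord0 i) = p.2 ord0 i.
Proof.
have -> : lift ord0 i = rshift 1 i by exact/val_inj.
exact: row_mxEr.
Qed.

Lemma dotr_cons n (p q : R * 'rV[R]_n) :
  dotr (rV_cons p) (rV_cons q) = p.1 * q.1 + dotr p.2 q.2.
Proof.
rewrite /dotr big_ord_recl !rV_cons0; congr (_ + _).
by apply: eq_bigr => i _; rewrite !rV_consS.
Qed.

Lemma measurable_dotr d (T : measurableType d) n (f g : T -> 'rV[R]_n) :
  measurable_fun setT f -> measurable_fun setT g ->
  measurable_fun setT (fun z => dotr (f z) (g z)).
Proof.
move=> mf mg; apply: measurable_sum => i; apply: measurable_funM.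
  exact: (measurableT_comp (measurable_rV_coord i) mf).
exact: (measurableT_comp (measurable_rV_coord i) mg).
Qed.

Lemma ge0_integral_cons n (f : 'rV[R]_n.+1 -> \bar R) :
  measurable_fun setT f -> (forall x, 0 <= f x)%E ->
  (\int[mu n.+1]_x f x = \int[lam \x mu n]_p f (rV_cons p))%E.
Proof.
move=> mf f0.
by rewrite [LHS](@ge0_integral_pushforward _ _ _ _ _ _ (@measurable_rV_cons R n)).
Qed.

(** The measure on R^(n+1) is the image of a product measure, and real integrals
are differences of two nonnegative ones. *)
Lemma Rint_cons n (f : 'rV[R]_n.+1 -> R) : measurable_fun setT f ->
  \int[mu n.+1]_x f x = \int[(lam \x mu n)%E]_p f (rV_cons p).
Proof.
move=> mf; rewrite /Rintegral [in LHS]integralE [in RHS]integralE; congr (fine (_ - _)%E).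
  rewrite ge0_integral_cons//.
    by apply: eq_integral => p _; rewrite !funeposE.
  by apply: measurable_funepos; exact/measurable_EFinP.
rewrite ge0_integral_cons//.
  by apply: eq_integral => p _; rewrite !funenegE.
by apply: measurable_funeneg; exact/measurable_EFinP.
Qed.

Lemma cint_cons n (f : 'rV[R]_n.+1 -> R[i]) : cmeas f ->
  cint (mu n.+1) f = cint (lam \x mu n)%E (fun p => f (rV_cons p)).
Proof. by move=> [f1 f2]; apply: complex_eq; rewrite /cint/= Rint_cons. Qed.

Definition box n (r : R) : set 'rV[R]_n := [set x | forall i, `|x ord0 i| <= r].
Arguments box : clear implicits.

Lemma box_cons n r : box n.+1 r = @rV_uncons R n @^-1` (`[- r, r]%classic `*` box n r).
Proof.
apply/seteqP; split => x /=.
  move=> h; split; first by rewrite /= in_itv/= -ler_norml; exact: h.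
  by move=> i; rewrite mxE; exact: h.
rewrite in_itv/= -ler_norml => -[h0 h] i.
case: (@split_ordP 1 n i) => j ->.
  by move: h0; rewrite !ord1 (_ : lshift n ord0 = ord0)//; exact/val_inj.
by have := h j; rewrite mxE.
Qed.

Lemma measurable_box n r : measurable (box n r).
Proof.
elim: n => [|n IH].
  by rewrite (_ : box 0 r = setT)//; apply/seteqP; split => // x _ [].
rewrite box_cons -[X in measurable X]setTI; apply: measurable_rV_uncons => //.
by apply: measurableX => //; exact: measurable_itv.
Qed.

Lemma measure_box n r : 0 <= r -> mu n (box n r) = ((2 * r) ^+ n)%:E.
Proof.
move=> r0; elim: n => [|n IH].
  by rewrite (_ : box 0 r = setT) /= ?diracT//; apply/seteqP; split => // x _ [].
rewrite [LHS](_ : _ = (lam \x mu n)%E (`[- r, r]%classic `*` box n r)).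
  rewrite product_measure1E; [|exact: measurable_itv|exact: measurable_box].
  rewrite [X in (_ * X)%E]IH exprS EFinM; congr (_ * _)%E.
  have := @lebesgue_measure_itv R `[- r, r]; rewrite /= => ->.
  rewrite lte_fin; case: ltP => h; first by rewrite -EFinB; congr EFin; ring.
  by congr EFin; lra.
rewrite /= /rV_lebesgue_step /pushforward box_cons; congr (product_measure1 _ _ _).
by apply/seteqP; split => p; rewrite /preimage /mkset rV_consK.
Qed.

Lemma integrable_box n (M r : R) :
  (mu n).-integrable setT (EFin \o (fun x => M * \1_(box n r) x)).
Proof.
apply: integrableRZl; apply/integrableP; split.
  by apply/measurable_EFinP; apply: measurable_indic; exact: measurable_box.
under eq_integral => x _ do rewrite /= ger0_norm//.
rewrite integral_indic//; last exact: measurable_box.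
rewrite setIT; apply: (@le_lt_trans _ _ (mu n (box n (Num.max r 0)))).
  rewrite le_measure ?inE//; [exact: measurable_box|exact: measurable_box|].
  by move=> x h i; rewrite le_max h.
by rewrite measure_box ?ltry// le_max lexx orbT.
Qed.

Lemma indic_box_cons n (r : R) t (y : 'rV[R]_n) :
  \1_(box n.+1 r) (rV_cons (t, y)) = \1_`[- r, r]%classic t * \1_(box n r) y :> R.
Proof.
rewrite !indicE -natrM mulnb; congr (_%:R); congr nat_of_bool.
by apply/idP/andP; rewrite !inE box_cons /preimage /mkset rV_consK => -[].
Qed.

End boxes.
Arguments box {R} n r.

(** * Plancherel identity for bounded functions *)

Section bounded_plancherel.
Context {R : realType}.
Local Notation lam := (@lebesgue_measure R).
Local Notation mu := (@rV_lebesgue R).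

Lemma cmeas_fourierL1 n (f : 'rV[R]_n -> R[i]) : cmeas f -> cmeas (fourierL1 f).
Proof.
move=> mf.
have mg : cmeas (fun z : 'rV[R]_n * 'rV[R]_n => expi (- dotr z.2 z.1) * f z.2).
  apply: cmeasM; last exact: (cmeas_comp mf).
  apply: cmeas_expi; apply: measurableT_comp => //.
  exact: measurable_dotr.
exact: (cmeas_cint (mu n) mg).
Qed.

Lemma support_box_le n (f : 'rV[R]_n -> R[i]) (M r : R) :
  (forall x, Normc.normc (f x) <= M) -> (forall x, ~ box n r x -> f x = 0) ->
  forall x, Normc.normc (f x) <= M * \1_(box n r) x.
Proof.
move=> fM fr x; rewrite indicE; case: (boolP (x \in _)) => [_|/negP xr].
  by rewrite mulr1.
by rewrite fr ?Normc.normc0 ?mulr0// => h; apply: xr; rewrite inE.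
Qed.

Lemma cint0 d (T : measurableType d) (m : {measure set T -> \bar R}) :
  cint m (fun _ => 0) = 0.
Proof. by apply: complex_eq; rewrite /cint/= /Rintegral integral0. Qed.

Lemma cint_dirac d (T : measurableType d) (a : T) (f : T -> R[i]) :
  cmeas f -> cint (\d_a : {measure set T -> \bar R}) f = f a.
Proof.
move=> [f1 f2]; apply: complex_eq; rewrite /cint/= /Rintegral.
  by rewrite integral_dirac//; [rewrite diracT mul1e|exact/measurable_EFinP].
by rewrite integral_dirac//; [rewrite diracT mul1e|exact/measurable_EFinP].
Qed.

(** Induction on the dimension.  The transform on R^(n+1) is the transform on R^n
of the partial transform in the first coordinate, which is again bounded and
supported in a box.  So the induction hypothesis treats the last n frequencies
for each fixed first frequency, and the identity on the line treats the
first frequency for each fixed value of the last n coordinates. *)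
Lemma bounded_plancherel n (f : 'rV[R]_n -> R[i]) (M r : R) :
  cmeas f -> (forall x, Normc.normc (f x) <= M) ->
  (forall x, ~ box n r x -> f x = 0) ->
  energy (mu n) (fourierL1 f) = (((2 * pi) ^+ n)%:E * energy (mu n) f)%E.
Proof.
elim: n f M r => [|n IH] f M r mf fM fr.
  rewrite expr0 mul1e; apply: eq_integral => x _; congr (sqn _)%:E.
  (* On R^0, a point of mass 1, the transform is the identity. *)
  transitivity (expi (- dotr (0 : 'rV[R]_0) x) * f 0).
    apply: (@cint_dirac _ _ (0 : 'rV[R]_0) (fun y => expi (- dotr y x) * f y)).
    apply: cmeasM => //; apply: cmeas_expi; apply: measurableT_comp => //.
    exact: measurable_dotr.
  rewrite /dotr big_ord0 oppr0 /expi cos0 sin0 mul1r.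
  by rewrite (thinmx0 x).
have M0 : 0 <= M by exact: le_trans (normc_ge0 _) (fM 0).
pose Phi xi (y : 'rV[R]_n) := fourier_line (fun t => f (rV_cons (t, y))) xi.
have mPhi : cmeas (fun p : R * 'rV[R]_n => Phi p.1 p.2).
  have mg : cmeas (fun z : (R * 'rV[R]_n) * R =>
      expi (- (z.2 * z.1.1)) * f (rV_cons (z.2, z.1.2))).
    apply: cmeasM.
      apply: cmeas_expi; apply: measurableT_comp => //.
      apply: measurable_funM => //.
      by apply: (measurableT_comp measurable_fst); exact: measurable_fst.
    apply: (cmeas_comp mf); apply: (measurableT_comp (@measurable_rV_cons R n)).
    apply: measurable_fun_pair => //.
    by apply: (measurableT_comp measurable_snd); exact: measurable_fst.
  exact: (cmeas_cint lam mg).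
have mft y : cmeas (fun t : R => f (rV_cons (t, y))).
  apply: (cmeas_comp mf); apply: (measurableT_comp (@measurable_rV_cons R n)).
  exact: measurable_fun_pair.
have fB t y : Normc.normc (f (rV_cons (t, y))) <=
    M * \1_`[- r, r]%classic t * \1_(box n r) y.
  by have := support_box_le fM fr (rV_cons (t, y)); rewrite indic_box_cons mulrA.
have mline (xi : R) (y : 'rV[R]_n) :
    cmeas (fun t : R => expi (- (t * xi)) * f (rV_cons (t, y))).
  apply: cmeasM; last exact: mft.
  by apply: cmeas_expi; apply: measurableT_comp => //; exact: mulrr_measurable.
have PhiB xi y : Normc.normc (Phi xi y) <= 2 * \int[lam]_t (M * \1_`[- r, r]%classic t).
  apply: (@normc_cint_le _ _ _ lam _ (fun t => M * \1_`[- r, r]%classic t)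
    (mline xi y));
    last exact: integrable_cst_itv.
  move=> t; rewrite Normc.normcM normc_expi mul1r (le_trans (fB _ _))//.
  by rewrite ler_piMr ?mulr_ge0// indicE lern1 leq_b1.
have Phir xi y : ~ box n r y -> Phi xi y = 0.
  move=> yr; rewrite /Phi /fourier_line -[RHS](cint0 lam); apply: eq_cint => t.
  rewrite fr ?mulr0// => h; apply: yr => i.
  by have := h (lift ord0 i); rewrite rV_consS.
have key xi (eta : 'rV[R]_n) : fourierL1 f (rV_cons (xi, eta)) = fourierL1 (Phi xi) eta.
  have mg : cmeas (fun x => expi (- dotr x (rV_cons (xi, eta))) * f x).
    apply: cmeasM => //; apply: cmeas_expi; apply: measurableT_comp => //.
    exact: measurable_dotr.
  transitivity (cint (mu n.+1) (fun x => expi (- dotr x (rV_cons (xi, eta))) * f x)) => //.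
  rewrite cint_cons// (@cint_fubini2 _ _ _ _ _ lam (mu n) _
    (fun t => M * \1_`[- r, r]%classic t) (\1_(box n r))); last 4 first.
  - by apply: (cmeas_comp mg); exact: measurable_rV_cons.
  - exact: integrable_cst_itv.
  - have := @integrable_box R n 1 r; apply: eq_integrable => // x _ /=.
    by rewrite mul1r.
  - by move=> t y; rewrite Normc.normcM normc_expi mul1r.
  apply: eq_cint => y; rewrite -cintZl; last first.
    apply: (@cintegrable_le _ _ _ lam _ (fun t => M * \1_`[- r, r]%classic t)).
    - exact: mline.
    - move=> t; rewrite Normc.normcM normc_expi mul1r (le_trans (fB _ _))//.
      by rewrite ler_piMr ?mulr_ge0// indicE lern1 leq_b1.
    - exact: integrable_cst_itv.
  by apply: eq_cint => t; rewrite dotr_cons/= mulrA -expiD opprD addrC.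
have mF := cmeas_fourierL1 mf.
have msq (h : 'rV[R]_n.+1 -> R[i]) : cmeas h -> measurable_fun setT
    (fun p : R * 'rV[R]_n => (sqn (h (rV_cons p)))%:E).
  move=> mh; apply/measurable_EFinP; apply: measurable_sqn.
  by apply: (cmeas_comp mh); exact: measurable_rV_cons.
have msqP : measurable_fun setT (fun p : R * 'rV[R]_n => (sqn (Phi p.1 p.2))%:E).
  by apply/measurable_EFinP; exact: measurable_sqn.
have mPx (xi : R) : cmeas (Phi xi).
  have [p1 p2] := mPhi; split.
    exact: (measurableT_comp p1 (measurable_pair1 xi)).
  exact: (measurableT_comp p2 (measurable_pair1 xi)).
have slice (xi : R) := IH (Phi xi) _ r (mPx xi) (PhiB xi) (Phir xi).
rewrite /energy ge0_integral_cons; last 2 first.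
- by apply/measurable_EFinP; exact: measurable_sqn.
- by move=> x; rewrite lee_fin sqn_ge0.
rewrite ge0_integral_cons; last 2 first.
- by apply/measurable_EFinP; exact: measurable_sqn.
- by move=> x; rewrite lee_fin sqn_ge0.
rewrite fubini_tonelli1; last 2 first.
- exact: msq.
- by move=> x; rewrite lee_fin sqn_ge0.
rewrite fubini_tonelli2; last 2 first.
- exact: msq.
- by move=> x; rewrite lee_fin sqn_ge0.
transitivity (\int[lam]_xi (((2 * pi) ^+ n)%:E * \int[mu n]_y (sqn (Phi xi y))%:E))%E.
  apply: eq_integral => xi _; rewrite /fubini_F.
  under eq_integral do rewrite key.
  exact: slice.
rewrite ge0_integralZl//; last 3 first.
- apply: (measurable_fun_fubini_tonelli_F (fun p : R * 'rV[R]_n =>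
    (sqn (Phi p.1 p.2))%:E)) => // p.
  by rewrite lee_fin sqn_ge0.
- by move=> xi _; apply: integral_ge0 => y _; rewrite lee_fin sqn_ge0.
- by rewrite lee_fin exprn_ge0// mulr_ge0// pi_ge0.
transitivity (((2 * pi) ^+ n)%:E * \int[mu n]_y \int[lam]_x (sqn (Phi x y))%:E)%E.
  congr (_ * _)%E.
  apply: (@fubini_tonelli _ _ _ _ R lam (mu n)
    (fun p : R * 'rV[R]_n => (sqn (Phi p.1 p.2))%:E)) => //.
  by move=> p; rewrite lee_fin sqn_ge0.
rewrite exprSr EFinM -muleA; congr (_ * _)%E.
rewrite -ge0_integralZl//; last 3 first.
- apply: (@measurable_fun_fubini_tonelli_G _ _ _ _ R lam
    (fun p : R * 'rV[R]_n => (sqn (f (rV_cons p)))%:E)).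
    exact: msq.
  by move=> p; rewrite lee_fin sqn_ge0.
- by move=> xi _; apply: integral_ge0 => y _; rewrite lee_fin sqn_ge0.
- by rewrite lee_fin mulr_ge0// pi_ge0.
apply: eq_integral => y _; rewrite /fubini_G.
apply: (@fourier_line_plancherel R (fun t => f (rV_cons (t, y))) M r) => //.
move=> t rt; apply: fr => h; move: rt; rewrite ltNge.
by have := h ord0; rewrite rV_cons0 => ->.
Qed.

End bounded_plancherel.

(** * The L2 seminorm *)

Section L2_seminorm.
Context {R : realType} d (T : measurableType d) (mu : {measure set T -> \bar R}).
Implicit Types f g h : T -> R[i].
Local Notation Re := (@complex.Re R).
Local Notation Im := (@complex.Im R).

(** The L2 norm over an arbitrary measure, convertible to [L2norm] for Lebesgue
measure on R^n. *)
Definition nrm f : \bar R := ('N[mu]_2%:E[EFin \o (@Normc.normc R \o f)])%E.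

Lemma nrmE f : nrm f = sqrte (energy mu f).
Proof.
rewrite /nrm unlock /Lnorm -poweR12_sqrt ?energy_ge0//; congr (_ `^ _)%E.
apply: eq_integral => x _ /=.
by rewrite ger0_norm ?normc_ge0// powR_mulrn ?normc_ge0// sqnE.
Qed.

Lemma nrm_ge0 f : (0 <= nrm f)%E. Proof. exact: Lnorm_ge0. Qed.

Lemma nrm_lty f : (nrm f < +oo)%E = (energy mu f < +oo)%E.
Proof.
rewrite -!ge0_fin_numE ?energy_ge0 ?nrm_ge0// nrmE.
exact: sqrte_fin_num (energy_ge0 _ _).
Qed.

Lemma nrm_le f g : (nrm f <= nrm g)%E = (energy mu f <= energy mu g)%E.
Proof. by rewrite !nrmE lee_sqrt// energy_ge0. Qed.

Lemma nrm_le_fin f (c : R) : 0 <= c ->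
  (nrm f <= c%:E)%E = (energy mu f <= (c ^+ 2)%:E)%E.
Proof.
move=> c0; rewrite nrmE -[in LHS](gee0_abs (x := c%:E)) ?lee_fin// -sqrte_sqr.
by rewrite lee_sqrt ?expe2 -?EFinM ?lee_fin ?sqr_ge0// -expr2.
Qed.

Lemma nrm_scale f g (c : R) : 0 <= c ->
  energy mu f = ((c ^+ 2)%:E * energy mu g)%E -> nrm f = (c%:E * nrm g)%E.
Proof.
move=> c0 fg; rewrite !nrmE fg sqrteM ?lee_fin ?sqr_ge0//.
by rewrite -[in RHS](gee0_abs (x := c%:E)) ?lee_fin// -sqrte_sqr.
Qed.

Lemma eq_nrm f g : f =1 g -> nrm f = nrm g.
Proof. by move=> /funext ->. Qed.

(** The triangle inequality for moduli reduces the claim to Minkowski's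
inequality for the real functions |f| and |g|. *)
Lemma nrmD_le f g : cmeas f -> cmeas g ->
  (nrm (fun x => (f x + g x)%R) <= nrm f + nrm g)%E.
Proof.
move=> mf mg.
have mn := measurable_normc mf; have mn' := measurable_normc mg.
pose k x : R[i] := (Normc.normc (f x) + Normc.normc (g x))%:C.
have mk : cmeas k by apply: cmeas_real; exact: measurable_funD.
have nk x : Normc.normc (k x) = Normc.normc (f x) + Normc.normc (g x).
  by rewrite /k /= expr0n/= addr0 sqrtr_sqr ger0_norm// addr_ge0 ?normc_ge0.
apply: (@le_trans _ _ (nrm k)).
  rewrite nrm_le; apply: le_energy => //; first exact: cmeasD.
  move=> x; rewrite -!sqnE lerXn2r ?nnegrE ?normc_ge0// nk.
  exact: (@le_normcD R (f x) (g x)).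
rewrite (_ : nrm k = ('N[mu]_2%:E[EFin \o
    ((@Normc.normc R \o f) \+ (@Normc.normc R \o g))%R])%E).
  by apply: minkowski_EFin => //; rewrite ler1n.
by apply: eq_Lnorm => x; congr EFin; exact: nk.
Qed.

Lemma nrmB_sym f g : nrm (fun x => f x - g x) = nrm (fun x => g x - f x).
Proof.
rewrite !nrmE; congr sqrte; apply: eq_integral => x _.
by rewrite sqnB_sym.
Qed.

Lemma nrmB_le f g : cmeas f -> cmeas g ->
  (nrm f <= nrm g + nrm (fun x => (f x - g x)%R))%E.
Proof.
move=> mf mg; have := nrmD_le mg (cmeasB mf mg).
by rewrite (@eq_nrm _ f)// => x; rewrite addrC subrK.
Qed.

Lemma nrm_cvg (h : nat -> T -> R[i]) g : (forall k, cmeas (h k)) -> cmeas g ->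
  (nrm g < +oo)%E -> nrm (fun x => h k x - g x) @[k --> \oo] --> 0%E ->
  nrm (h k) @[k --> \oo] --> nrm g.
Proof.
move=> mh mg gfin hg.
have gf : nrm g \is a fin_num by rewrite ge0_fin_numE// nrm_ge0.
apply: (@squeeze_cvge _ _ _ _ (fun k => nrm g - nrm (fun x => (h k x - g x)%R))%E _
  (fun k => nrm g + nrm (fun x => (h k x - g x)%R))%E).
- near=> k; apply/andP; split; last exact: nrmB_le.
  rewrite leeBlDr; last first.
    near: k; have [+ _] := (fine_cvgP _ _).1 hg.
    by apply: filterS.
  by rewrite nrmB_sym; exact: nrmB_le.
- rewrite -[X in _ --> X]sube0; apply: cvgeB => //.
    by rewrite fin_num_adde_defr.
  exact: cvg_cst.
- rewrite -[X in _ --> X]adde0; apply: cvgeD => //.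
    by rewrite fin_num_adde_defr.
  exact: cvg_cst.
Unshelve. all: by end_near. Qed.

End L2_seminorm.
Arguments nrm {R d T} mu f.

(** * Completeness of L2 *)

Section riesz_fischer.
Context {R : realType} d (T : measurableType d) (mu : {measure set T -> \bar R}).
Local Notation Re := (@complex.Re R).
Local Notation Im := (@complex.Im R).

Lemma cvg_of_geometric_steps (u : R^nat) (C : R) :
  (forall k, `|u k.+1 - u k| <= C / 2 ^+ k) -> cvgn u.
Proof.
move=> uC.
have : cvgn (series (fun k => u k.+1 - u k)).
  apply: normed_cvg; apply: (series_le_cvg (v_ := geometric C 2^-1)).
  - by move=> k; exact: normr_ge0.
  - move=> k; rewrite /geometric/= mulr_ge0 ?exprn_ge0 ?invr_ge0//.
    by have := le_trans (normr_ge0 _) (uC 0%N); rewrite expr0 divr1.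
  - by move=> k; rewrite /geometric/= exprVn.
  - by apply: is_cvg_geometric_series; rewrite ger0_norm ?invr_ge0// invf_lt1// ltr1n.
rewrite (_ : series _ = (fun k => u k - u 0%N)); last first.
  by apply/funext => k; rewrite /series/= telescope_sumr.
move=> h; rewrite (_ : u = (fun k => (u k - u 0%N) + u 0%N)).
  by apply: is_cvgD => //; exact: is_cvg_cst.
by apply/funext => k; rewrite subrK.
Qed.

(** Fatou's lemma for the sequence |f - h_k|^2. *)
Lemma energy_lim_le (h : nat -> T -> R[i]) (f g : T -> R[i]) (e : R) (N : nat) :
  (forall k, cmeas (h k)) -> cmeas f -> cmeas g ->
  {ae mu, forall x, (Re (h k x) @[k --> \oo] --> Re (g x)) /\
                    (Im (h k x) @[k --> \oo] --> Im (g x))} ->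
  (forall k, (N <= k)%N -> (energy mu (fun x => (f x - h k x)%R) <= e%:E)%E) ->
  (energy mu (fun x => (f x - g x)%R) <= e%:E)%E.
Proof.
move=> mh mf mg hg he.
pose u k x : \bar R := (sqn (f x - h (k + N)%N x))%:E.
have mu_ k : measurable_fun setT (u k).
  by apply/measurable_EFinP; apply: measurable_sqn; exact: cmeasB.
have -> : energy mu (fun x => (f x - g x)%R) =
    (\int[mu]_x limn_einf (u ^~ x))%E.
  apply: ge0_ae_eq_integral => //.
  - by apply/measurable_EFinP; apply: measurable_sqn; exact: cmeasB.
  - apply: measurableT_comp => //; apply: (@measurable_fun_limn_esup _ _ _ _
      (fun k x => (- u k x)%E)) => k.
    exact: measurableT_comp.
  - by move=> x _; rewrite lee_fin sqn_ge0.
  - move=> x _; rewrite limn_einf_lim; apply: lime_ge; first exact: is_cvg_einfs.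
    by apply: nearW => k; apply: le_ereal_inf_tmp => _ [j _ <-]; rewrite lee_fin sqn_ge0.
  - apply: filterS hg => x [h1 h2] _; apply/esym.
    have : u ^~ x @ \oo --> (sqn (f x - g x))%:E.
      apply/cvg_EFin; first exact: nearW.
      rewrite (cvg_shiftn N (fun k => sqn (f x - h k x))) /sqn.
      under eq_fun do rewrite cReB cImB.
      rewrite cReB cImB !expr2.
      by apply: cvgD; apply: cvgM; apply: cvgB => //; exact: cvg_cst.
    by move/cvg_limn_einf_sup => [].
apply: (le_trans (fatou mu measurableT mu_ _)).
  by move=> k x _; rewrite lee_fin sqn_ge0.
rewrite limn_einf_lim; apply: lime_le; first exact: is_cvg_einfs.
apply: nearW => k; apply: (@le_trans _ _ (energy mu (fun x => (f x - h (k + N)%N x)%R))).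
  by apply: ereal_inf_lbound; exists k => /=.
by apply: he; exact: leq_addl.
Qed.

(** The usual proof: a subsequence with rapidly decreasing steps converges almost
everywhere, and Fatou's lemma shows that its limit is a limit in L2 of the
whole sequence. *)
Lemma riesz_fischer (h : nat -> T -> R[i]) : (forall k, cmeas (h k)) ->
  (forall e : R, 0 < e -> exists N, forall p q, (N <= p)%N -> (N <= q)%N ->
    (energy mu (fun x => (h p x - h q x)%R) <= e%:E)%E) ->
  exists g, cmeas g /\ forall e : R, 0 < e -> exists N, forall p, (N <= p)%N ->
    (energy mu (fun x => (h p x - g x)%R) <= e%:E)%E.
Proof.
move=> mh hC.
(* Steps of energy at most 16^-k: after multiplication by 4^k their sum is still
   integrable, hence finite almost everywhere, and then the k-th step of the
   subsequence is O(2^-k) at almost every point. *)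
have [n0 n0P] : exists n0 : nat -> nat, forall k p q, (n0 k <= p)%N -> (n0 k <= q)%N ->
    (energy mu (fun x => (h p x - h q x)%R) <= (16 ^- k)%:E)%E.
  have e0 k : 0 < 16 ^- k :> R by rewrite invr_gt0 exprn_gt0.
  exists (fun k => projT1 (cid (hC _ (e0 k)))) => k p q.
  exact: (projT2 (cid (hC _ (e0 k)))).
pose phi k := (\sum_(j < k.+1) (n0 j).+1)%N.
have n0phi k : (n0 k <= phi k)%N by rewrite /phi big_ord_recr/= (leq_trans (leqnSn _))// leq_addl.
have phiS k : (phi k <= phi k.+1)%N by rewrite /phi [leqRHS]big_ord_recr/= leq_addr.
pose dd k x := h (phi k.+1) x - h (phi k) x.
have mdd k : cmeas (dd k) by exact: cmeasB.
have edd k : (energy mu (dd k) <= (16 ^- k)%:E)%E.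
  by apply: n0P => //; exact: leq_trans (phiS k).
pose G x := (\sum_(k <oo) (4 ^+ k * sqn (dd k x))%:E)%E.
have mterm k : measurable_fun setT (fun x => (4 ^+ k * sqn (dd k x))%:E).
  apply/measurable_EFinP; apply: measurable_funM => //; exact: measurable_sqn.
have term0 k x : (0 <= (4 ^+ k * sqn (dd k x))%:E)%E.
  by rewrite lee_fin mulr_ge0 ?exprn_ge0 ?sqn_ge0.
have intG : (\int[mu]_x G x < +oo)%E.
  rewrite integral_nneseries//.
  apply: (@le_lt_trans _ _ (\sum_(k <oo) (2 / (2 ^ (k + 1))%:R : R)%:E)%E); last first.
    by rewrite (cvg_lim _ (@cvg_geometric_eseries_half R 2 0))// ltry.
  apply: lee_nneseries => k _; first by move=> _; apply: integral_ge0.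
  under eq_integral do rewrite EFinM.
  rewrite ge0_integralZl//; last 2 first.
  - by apply/measurable_EFinP; exact: measurable_sqn.
  - by move=> x _; rewrite lee_fin sqn_ge0.
  apply: (@le_trans _ _ ((4 ^+ k)%:E * (16 ^- k)%:E)%E).
    by rewrite lee_wpmul2l ?lee_fin ?exprn_ge0//; exact: edd.
  rewrite -EFinM lee_fin (_ : 16 = 4 * 4 :> R); last by ring.
  rewrite exprMn invfM mulrA divff ?expf_neq0// mul1r.
  rewrite (_ : 2 / _ = 2 ^- k); last first.
    by rewrite expnD expn1 natrM natrX invfM mulrCA divff// mulr1.
  by rewrite lef_pV2 ?posrE ?exprn_gt0// lerXn2r ?nnegrE// ler_nat.
have mG : measurable_fun setT G by exact: ge0_emeasurable_sum.
have G0 x : (0 <= G x)%E by exact: nneseries_ge0.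
have Gfin : {ae mu, forall x, (G x < +oo)%E}.
  have iG : mu.-integrable setT G.
    by apply/integrableP; split => //; under eq_integral do rewrite gee0_abs//.
  apply: filterS (integrable_ae measurableT iG) => x /(_ I).
  by rewrite ge0_fin_numE.
(* An upper limit is measurable and defined everywhere; it is the limit wherever
   the subsequence converges. *)
pose re x := fine (limn_esup (fun k => (Re (h (phi k) x))%:E)).
pose im x := fine (limn_esup (fun k => (Im (h (phi k) x))%:E)).
pose g x := re x +i* im x.
have mg : cmeas g.
  have mfine (v : nat -> T -> R) : (forall k, measurable_fun setT (v k)) ->
      measurable_fun setT (fun x => fine (limn_esup (fun k => (v k x)%:E))).
    move=> mv; apply: (@measurableT_comp _ _ _ _ _ _ fine).
      exact: fine_measurable.
    apply: (@measurable_fun_limn_esup _ _ _ _ (fun k x => (v k x)%:E)) => k.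
    by apply/measurable_EFinP; exact: mv.
  split.
    by apply: (mfine (fun k x => Re (h (phi k) x))) => k; have [] := mh (phi k).
  by apply: (mfine (fun k x => Im (h (phi k) x))) => k; have [] := mh (phi k).
have hg : {ae mu, forall x, (Re (h (phi k) x) @[k --> \oo] --> Re (g x)) /\
                    (Im (h (phi k) x) @[k --> \oo] --> Im (g x))}.
  apply: filterS Gfin => x Gx.
  have step k : Normc.normc (dd k x) <= (fine (G x) + 1) / 2 ^+ k.
    have Gf : G x = (fine (G x))%:E by rewrite fineK// ge0_fin_numE.
    have g0 : 0 <= fine (G x) by rewrite fine_ge0.
    have : ((4 ^+ k * sqn (dd k x))%:E <= G x)%E.
      apply: le_trans (nneseries_lim_ge k.+1 _) => //.
      by rewrite big_nat_recr//= leeDr// sume_ge0.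
    rewrite Gf lee_fin => h4.
    rewrite -(@ler_pXn2r _ 2)// ?nnegrE ?normc_ge0 ?divr_ge0 ?addr_ge0 ?exprn_ge0//.
    rewrite sqnE exprMn exprVn -exprM mulnC exprM ler_pdivlMr ?exprn_gt0//.
    rewrite (_ : 2 ^+ 2 = 4 :> R); last by ring.
    rewrite mulrC (le_trans h4)//; nra.
  have cvgfine (u : R^nat) : cvgn u -> u @ \oo --> fine (limn_esup (EFin \o u)).
    move=> /cvg_ex[l ul].
    have : EFin \o u @ \oo --> l%:E by apply/cvg_EFin => //; exact: nearW.
    by move=> /cvg_limn_einf_sup[_ ->].
  split; rewrite /g/=; apply: cvgfine; apply: cvg_of_geometric_steps => k.
    by rewrite -cReB; exact: le_trans (normr_Re_le _) (step k).
  by rewrite -cImB; exact: le_trans (normr_Im_le _) (step k).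
exists g; split => // e e0.
have [N NP] := hC _ e0.
exists N => p Np.
have phi_ge k : (k <= phi k)%N.
  elim: k => // k IH; rewrite (_ : phi k.+1 = phi k + (n0 k.+1).+1)%N.
    by rewrite addnS ltnS (leq_trans IH)// leq_addr.
  by rewrite /phi big_ord_recr.
apply: (@energy_lim_le (fun k => h (phi k)) _ _ _ N) => // k Nk.
by apply: NP => //; exact: leq_trans (phi_ge k).
Qed.

End riesz_fischer.

(** * Convergence to zero in L2 *)

Section L2_limits.
Context {R : realType} d (T : measurableType d) (mu : {measure set T -> \bar R}).

Lemma nrm_cvg0 (h : nat -> T -> R[i]) :
  (forall e : R, 0 < e -> exists N, forall k, (N <= k)%N -> (energy mu (h k) <= e%:E)%E) ->
  nrm mu (h k) @[k --> \oo] --> 0%E.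
Proof.
move=> H.
have fin : \forall k \near \oo, nrm mu (h k) \is a fin_num.
  have [N NP] := H 1 ltr01; exists N => // k /= Nk.
  by rewrite ge0_fin_numE ?nrm_ge0// nrm_lty (le_lt_trans (NP k Nk))// ltry.
apply/fine_cvgP; split => //; apply/cvgrPdist_le => e e0.
have e2 : 0 < e ^+ 2 by rewrite exprn_gt0.
have [N NP] := H _ e2.
near=> k.
rewrite /= sub0r normrN ger0_norm ?fine_ge0 ?nrm_ge0// -lee_fin fineK; last by near: k.
by rewrite (nrm_le_fin mu _ (ltW e0)); apply: NP; near: k; exists N.
Unshelve. all: by end_near. Qed.

Lemma energy_small (h : nat -> T -> R[i]) :
  energy mu (h k) @[k --> \oo] --> 0%E ->
  forall e : R, 0 < e -> exists N, forall k, (N <= k)%N -> (energy mu (h k) <= e%:E)%E.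
Proof.
move=> /fine_cvgP[fin /cvgrPdist_le cv] e e0.
have [N _ NP] := fin; have [N' _ NP'] := cv _ e0.
exists (maxn N N') => k; rewrite geq_max => /andP[Nk Nk'].
rewrite -(fineK (NP _ Nk)) lee_fin.
by have := NP' _ Nk'; rewrite /= sub0r normrN; apply: le_trans; exact: ler_norm.
Qed.

Lemma energy_dominated_cvg0 (h : nat -> T -> R[i]) (f : T -> R[i]) :
  (forall k, cmeas (h k)) -> cmeas f -> (energy mu f < +oo)%E ->
  (forall k x, sqn (h k x) <= sqn (f x)) ->
  (forall x, exists N, forall k, (N <= k)%N -> h k x = 0) ->
  energy mu (h k) @[k --> \oo] --> 0%E.
Proof.
move=> mh mf ffin hf h0.
have msf := measurable_sqn mf.
have [] := @dominated_convergence _ _ _ mu setT measurableT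
  (fun k x => (sqn (h k x))%:E) (cst 0%E) (fun x => (sqn (f x))%:E).
- by move=> k; apply/measurable_EFinP; exact: measurable_sqn.
- exact: measurable_cst.
- apply: aeW => x _; have [N NP] := h0 x.
  apply: (@cvg_trans _ (cst (0%E : \bar R) @ \oo)); last exact: cvg_cst.
  apply: near_eq_cvg; exists N => // k /= Nk.
  by rewrite NP// /sqn /= expr0n/= addr0.
- apply/integrableP; split; first exact/measurable_EFinP.
  by under eq_integral do rewrite gee0_abs ?lee_fin ?sqn_ge0//.
- by apply: aeW => x k _; rewrite gee0_abs ?lee_fin ?sqn_ge0.
by move=> _ _; rewrite integral0.
Qed.

End L2_limits.

(** * Plancherel identity for bounded supports *)

Section L2_plancherel.
Context {R : realType} {n : nat}.
Local Notation mu := (@rV_lebesgue R n).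
Implicit Types f g : 'rV[R]_n -> R[i].

(** Square-integrable functions of bounded support.  They are integrable, so
that their Fourier transform is given by an integral, and every truncation of
an L2 function to a ball is one of them. *)
Definition L2box f := exists r, [/\ cmeas f, (energy mu f < +oo)%E &
  forall x, ~ box n r x -> f x = 0].

Lemma sqn0 : sqn (0 : R[i]) = 0.
Proof. by rewrite /sqn/= expr0n/= addr0. Qed.

(** On a box of finite volume |f| <= 1 + |f|^2, and off the box f vanishes. *)
Lemma L2box_integrable f : L2box f ->
  mu.-integrable setT (EFin \o (fun x => Normc.normc (f x))).
Proof.
move=> [r [mf ffin fr]].
have i1 := @integrable_box R n 1 r.
have i2 : mu.-integrable setT (EFin \o (fun x => sqn (f x))).
  apply/integrableP; split; first by apply/measurable_EFinP; exact: measurable_sqn.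
  by under eq_integral do rewrite /= ger0_norm ?sqn_ge0//.
apply: (@integrable_le _ _ _ mu _ _ (measurable_normc mf) _ (integrableRD i1 i2)) => x.
rewrite ger0_norm ?normc_ge0// mul1r indicE; case: (boolP (x \in _)) => [_|/negP xr].
  have le1X2 (t : R) : t <= 1 + t ^+ 2 by nra.
  by rewrite -sqnE; exact: le1X2.
by rewrite fr ?Normc.normc0 ?add0r ?sqn_ge0// => h; apply: xr; rewrite inE.
Qed.

Lemma L2box_kernel_integrable f xi : L2box f ->
  cintegrable mu (fun x => expi (- dotr x xi) * f x).
Proof.
move=> Lf; have [r [mf _ _]] := Lf.
apply: cintegrable_le (L2box_integrable Lf).
  apply: cmeasM => //; apply: cmeas_expi; apply: measurableT_comp => //.
  exact: measurable_dotr.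
by move=> x; rewrite Normc.normcM normc_expi mul1r.
Qed.

Lemma L2boxB f g : L2box f -> L2box g -> L2box (fun x => f x - g x).
Proof.
move=> [r [mf ff fr]] [s [mg gf gs]]; exists (Num.max r s); split.
- exact: cmeasB.
- have mgN : cmeas (fun x => - g x).
    by have := cmeasB (cmeas_cst _ 0) mg; under eq_fun do rewrite sub0r.
  apply: (le_lt_trans (energyD_le mu mf mgN)).
  rewrite (_ : energy mu (fun x => - g x) = energy mu g); last first.
    by apply: eq_integral => x _; rewrite -[- g x]sub0r sqnB_sym subr0.
  by rewrite lte_add_pinfty// lte_mul_pinfty.
- move=> x xr; rewrite fr ?gs ?subr0// => h; apply: xr => i;
    by rewrite (le_trans (h i))// le_max lexx ?orbT.
Qed.

Lemma fourierL1B f g xi : L2box f -> L2box g ->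
  fourierL1 (fun x => f x - g x) xi = fourierL1 f xi - fourierL1 g xi.
Proof.
move=> Lf Lg.
transitivity (cint mu (fun x => expi (- dotr x xi) * f x - expi (- dotr x xi) * g x)).
  by apply: eq_cint => x; rewrite mulrBr.
by rewrite cintB//; exact: L2box_kernel_integrable.
Qed.

(** Unlike [trunc], which cuts the domain, this cuts the values and produces a
bounded function, to which [bounded_plancherel] applies. *)
Definition clip (N : nat) f : 'rV[R]_n -> R[i] :=
  fun x => if Normc.normc (f x) <= N%:R then f x else 0.

Lemma cmeas_clip N f : cmeas f -> cmeas (clip N f).
Proof.
move=> mf; apply: cmeas_if => //.
by apply: measurable_fun_ler => //; exact: measurable_normc.
Qed.

Lemma clip_eventually f x : exists N, forall k, (N <= k)%N -> clip k f x = f x.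
Proof.
exists (Num.truncn (Normc.normc (f x))).+1 => k Nk; rewrite /clip ifT//.
rewrite ltW// (lt_le_trans (truncnS_gt _))// ler_nat//.
Qed.

Lemma sqn_clipB_le N f x : sqn (clip N f x - f x) <= sqn (f x).
Proof.
by rewrite /clip; case: ifP => _; rewrite ?subrr ?sqn0 ?sqn_ge0// sqnB_sym subr0.
Qed.

Lemma sqn_clip_le N f x : sqn (clip N f x) <= sqn (f x).
Proof. by rewrite /clip; case: ifP => _ //; rewrite sqn0 sqn_ge0. Qed.

Lemma L2box_clip N f : L2box f -> L2box (clip N f).
Proof.
move=> [r [mf ff fr]]; exists r; split.
- exact: cmeas_clip.
- apply: le_lt_trans ff; apply: le_energy => //; first exact: cmeas_clip.
  by move=> x; exact: sqn_clip_le.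
- by move=> x xr; rewrite /clip fr// if_same.
Qed.

Definition plancherel_cst : R := Num.sqrt ((2 * pi) ^+ n).

Lemma plancherel_cst_ge0 : 0 <= plancherel_cst.
Proof. exact: sqrtr_ge0. Qed.

Lemma plancherel_cst_gt0 : 0 < plancherel_cst.
Proof. by rewrite sqrtr_gt0 exprn_gt0// mulr_gt0// pi_gt0. Qed.

Lemma plancherel_cst_sqr : plancherel_cst ^+ 2 = (2 * pi) ^+ n.
Proof. by rewrite sqr_sqrtr// exprn_ge0// mulr_ge0// pi_ge0. Qed.

Lemma clip_plancherel N f : L2box f ->
  nrm mu (fourierL1 (clip N f)) = (plancherel_cst%:E * nrm mu (clip N f))%E.
Proof.
move=> [r [mf ff fr]]; apply: nrm_scale; first exact: plancherel_cst_ge0.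
rewrite plancherel_cst_sqr; apply: (@bounded_plancherel R n _ N%:R r).
- exact: cmeas_clip.
- by move=> x; rewrite /clip; case: ifP => // _; rewrite Normc.normc0.
- by move=> x xr; rewrite /clip fr// if_same.
Qed.

(** The transform is bounded by the L1 norm up to a factor 2, and [clip N f]
tends to [f] in L1 by dominated convergence. *)
Lemma fourierL1_clip_cvg f xi : L2box f ->
  Normc.normc (fourierL1 (clip N f) xi - fourierL1 f xi) @[N --> \oo] --> 0.
Proof.
move=> Lf; have [r [mf _ _]] := Lf.
have inf := L2box_integrable Lf.
have mD N : cmeas (fun x => clip N f x - f x) by apply: cmeasB => //; exact: cmeas_clip.
have c0 : \int[mu]_x Normc.normc (clip N f x - f x) @[N --> \oo] --> 0.
  have [] := @dominated_convergence _ _ _ mu setT measurableT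
    (fun N x => (Normc.normc (clip N f x - f x))%:E) (cst 0%E)
    (EFin \o (fun x => Normc.normc (f x))).
  - by move=> N; apply/measurable_EFinP; exact: measurable_normc.
  - exact: measurable_cst.
  - apply: aeW => x _; have [N NP] := clip_eventually f x.
    apply: (@cvg_trans _ (cst (0%E : \bar R) @ \oo)); last exact: cvg_cst.
    apply: near_eq_cvg; exists N => // k /= Nk.
    by rewrite NP// subrr Normc.normc0.
  - exact: inf.
  - apply: aeW => x N _; rewrite gee0_abs ?lee_fin ?normc_ge0//=.
    rewrite -(@ler_pXn2r _ 2) ?nnegrE ?normc_ge0// !sqnE.
    exact: sqn_clipB_le.
  by move=> _ _; rewrite integral0 => hc; exact: (fine_cvg hc).
have c1 : 2 * \int[mu]_x Normc.normc (clip N f x - f x) @[N --> \oo] --> 0.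
  by rewrite -(mulr0 2); apply: cvgM => //; exact: cvg_cst.
apply: (squeeze_cvgr _ (cvg_cst 0) c1); apply: nearW => N.
rewrite normc_ge0 andTb -(fourierL1B xi (L2box_clip N Lf) Lf).
apply: (@normc_cint_le _ _ _ mu).
- apply: cmeasM => //; apply: cmeas_expi; apply: measurableT_comp => //.
  exact: measurable_dotr.
- by move=> x; rewrite Normc.normcM normc_expi mul1r.
- by apply: L2box_integrable; apply: L2boxB => //; exact: L2box_clip.
Qed.

(** The identity holds for the clipped functions, whose transforms converge
pointwise; only an inequality survives in the limit by Fatou's lemma. *)
Lemma plancherel_upper f : L2box f ->
  (nrm mu (fourierL1 f) <= plancherel_cst%:E * nrm mu f)%E.
Proof.
move=> Lf; have [r [mf ff fr]] := Lf.
have nf : nrm mu f \is a fin_num by rewrite ge0_fin_numE ?nrm_ge0// nrm_lty.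
rewrite -(fineK nf) -EFinM.
have c0 : 0 <= plancherel_cst * fine (nrm mu f).
  by rewrite mulr_ge0 ?plancherel_cst_ge0// fine_ge0// nrm_ge0.
have mF := cmeas_fourierL1 mf.
have mFN N := cmeas_fourierL1 (cmeas_clip N mf).
have E0 g : energy mu (fun x => 0 - g x) = energy mu g.
  by apply: eq_integral => x _; rewrite sqnB_sym subr0.
rewrite nrm_le_fin// -E0.
apply: (@energy_lim_le _ _ _ mu (fun N => fourierL1 (clip N f)) _ _ _ 0) => //.
- apply: aeW => xi; have := fourierL1_clip_cvg xi Lf => h.
  split; apply/cvgrPdist_le => e e0; move/cvgrPdist_le : h => /(_ e e0);
    apply: filterS => N; rewrite sub0r normrN ger0_norm ?normc_ge0// => h;
    rewrite distrC; apply: le_trans h.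
  + by rewrite -cReB; exact: normr_Re_le.
  + by rewrite -cImB; exact: normr_Im_le.
- move=> N _; rewrite E0 -nrm_le_fin// clip_plancherel// EFinM fineK//.
  rewrite lee_wpmul2l ?lee_fin ?plancherel_cst_ge0// nrm_le.
  by apply: le_energy => //; [exact: cmeas_clip|move=> x; exact: sqn_clip_le].
Qed.

(** The upper bound for the difference of [f] and its clipped versions turns
pointwise convergence of the transforms into convergence in L2, along which
the identity passes to the limit. *)
Lemma plancherel_L2box f : L2box f ->
  nrm mu (fourierL1 f) = (plancherel_cst%:E * nrm mu f)%E.
Proof.
move=> Lf; have [r [mf ff fr]] := Lf.
have nf : (nrm mu f < +oo)%E by rewrite nrm_lty.
have nF : (nrm mu (fourierL1 f) < +oo)%E.
  apply: (le_lt_trans (plancherel_upper Lf)).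
  by rewrite lte_mul_pinfty ?lee_fin ?plancherel_cst_ge0.
have mF := cmeas_fourierL1 mf.
have mFN N := cmeas_fourierL1 (cmeas_clip N mf).
have d0 : nrm mu (fun x => clip N f x - f x) @[N --> \oo] --> 0%E.
  apply: nrm_cvg0; apply: energy_small.
  apply: (energy_dominated_cvg0 (f := f)) => //.
  - by move=> k; apply: cmeasB => //; exact: cmeas_clip.
  - by move=> k x; exact: sqn_clipB_le.
  - move=> x; have [N NP] := clip_eventually f x; exists N => k Nk.
    by rewrite NP// subrr.
have c1 : nrm mu (clip N f) @[N --> \oo] --> nrm mu f.
  by apply: nrm_cvg => // N; exact: cmeas_clip.
have c2 : nrm mu (fourierL1 (clip N f)) @[N --> \oo] --> (plancherel_cst%:E * nrm mu f)%E.
  under eq_fun do rewrite clip_plancherel//.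
  by apply: cvgeZl.
apply: (cvg_unique _ _ c2); first exact: ereal_hausdorff.
apply: nrm_cvg => //.
have z : (plancherel_cst%:E * nrm mu (fun x => (clip N f x - f x)%R))%E @[N --> \oo] --> 0%E.
  by rewrite -(mule0 plancherel_cst%:E); apply: cvgeZl.
apply: (squeeze_cvge _ (cvg_cst 0%E) z); apply: nearW => N.
rewrite nrm_ge0/= (@eq_nrm _ _ _ _ _ (fourierL1 (fun x => clip N f x - f x))).
  by apply: plancherel_upper; apply: L2boxB => //; exact: L2box_clip.
by move=> xi; rewrite fourierL1B//; exact: L2box_clip.
Qed.

End L2_plancherel.

(** * Truncation to balls *)

Section truncation.
Context {R : realType} {n : nat}.
Local Notation mu := (@rV_lebesgue R n).
Implicit Types f g h : 'rV[R]_n -> R[i].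

Lemma coord_le_euclid (x : 'rV[R]_n) i : `|x ord0 i| <= euclid x.
Proof.
rewrite /euclid -sqrtr_sqr ler_wsqrtr// /dotr (bigD1 i)//= -expr2 lerDl.
by apply: sumr_ge0 => j _; rewrite -expr2 sqr_ge0.
Qed.

Lemma measurable_euclid : measurable_fun setT (@euclid R n).
Proof.
have ms : measurable_fun setT (@Num.sqrt R).
  by apply: continuous_measurable_fun; exact: sqrt_continuous.
by apply: (measurableT_comp ms); exact: measurable_dotr.
Qed.

Lemma cmeas_trunc N f : cmeas f -> cmeas (trunc N f).
Proof.
move=> mf; apply: cmeas_if => //.
by apply: measurable_fun_ler => //; exact: measurable_euclid.
Qed.

Lemma trunc_eventually f x : exists N, forall k, (N <= k)%N -> trunc k f x = f x.
Proof.
exists (Num.truncn (euclid x)).+1 => k Nk; rewrite /trunc ifT//.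
by rewrite ltW// (lt_le_trans (truncnS_gt _))// ler_nat.
Qed.

Lemma sqn_truncB_le N f x : sqn (trunc N f x - f x) <= sqn (f x).
Proof.
by rewrite /trunc; case: ifP => _; rewrite ?subrr ?sqn0 ?sqn_ge0// sqnB_sym subr0.
Qed.

Lemma sqn_trunc_le N f x : sqn (trunc N f x) <= sqn (f x).
Proof. by rewrite /trunc; case: ifP => _ //; rewrite sqn0 sqn_ge0. Qed.

(** Two truncations beyond radius N differ only where the truncation at N
vanishes.  This yields the Cauchy property. *)
Lemma sqn_truncBB_le N p q f x : (N <= p)%N -> (N <= q)%N ->
  sqn (trunc p f x - trunc q f x) <= sqn (trunc N f x - f x).
Proof.
move=> Np Nq; rewrite /trunc; case: (leP (euclid x) N%:R) => [xN|_].
  by rewrite !(le_trans xN) ?ler_nat// !subrr.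
rewrite [leRHS]sqnB_sym subr0.
by case: ifP => _; case: ifP => _; rewrite ?subrr ?sqn0 ?sqn_ge0 ?subr0// sqnB_sym subr0.
Qed.

Lemma L2_energy f : L2 f -> cmeas f /\ (energy mu f < +oo)%E.
Proof. by move=> [mf ff]; split => //; rewrite -nrm_lty. Qed.

Lemma L2box_trunc N f : L2 f -> L2box (trunc N f).
Proof.
move=> /L2_energy[mf ff]; exists N%:R; split.
- exact: cmeas_trunc.
- apply: le_lt_trans ff; apply: le_energy => //; first exact: cmeas_trunc.
  by move=> x; exact: sqn_trunc_le.
- move=> x xN; rewrite /trunc; case: ifP => // xN'; exfalso; apply: xN => i.
  exact: le_trans (coord_le_euclid x i) xN'.
Qed.

Lemma energy_truncB_cvg f : L2 f ->
  energy mu (fun x => trunc N f x - f x) @[N --> \oo] --> 0%E.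
Proof.
move=> /L2_energy[mf ff]; apply: (energy_dominated_cvg0 (f := f)) => //.
- by move=> k; apply: cmeasB => //; exact: cmeas_trunc.
- by move=> k x; exact: sqn_truncB_le.
- move=> x; have [N NP] := trunc_eventually f x; exists N => k Nk.
  by rewrite NP// subrr.
Qed.

Lemma nrm_trunc_cvg f : L2 f -> nrm mu (trunc N f) @[N --> \oo] --> nrm mu f.
Proof.
move=> Lf; have [mf ff] := Lf; apply: nrm_cvg => //.
  by move=> k; exact: cmeas_trunc.
by apply: nrm_cvg0; apply: energy_small; exact: energy_truncB_cvg.
Qed.

End truncation.

(** * Extension of scaled isometries to L2 *)

Section isometric_extension.
Context {R : realType} {n : nat}.
Local Notation mu := (@rV_lebesgue R n).
Implicit Types f g h : 'rV[R]_n -> R[i].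
Variables (Tr : ('rV[R]_n -> R[i]) -> 'rV[R]_n -> R[i]) (c : R).
Hypothesis c0 : 0 <= c.
Hypothesis TrM : forall f, L2box f -> cmeas (Tr f).
Hypothesis TrB : forall f g, L2box f -> L2box g ->
  Tr (fun x => f x - g x) =1 (fun x => Tr f x - Tr g x).
Hypothesis Tr_nrm : forall f, L2box f -> nrm mu (Tr f) = (c%:E * nrm mu f)%E.

(** The property by which [fourier] and [inv_fourier] are chosen, for the
transforms [fourierL1] and [inv_fourierL1]. *)
Definition is_extension g h : Prop :=
  L2 h /\ (fun N : nat => L2norm (fun x => Tr (trunc N g) x - h x)) @ \oo --> 0%E.

(** A map that preserves norms up to the factor [c] sends the Cauchy sequence of
truncations to a Cauchy sequence. *)
Lemma extension_exists g : L2 g -> exists h, is_extension g h.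
Proof.
move=> Lg; have Lt N := L2box_trunc N Lg.
have [h [mh hlim]] : exists h, cmeas h /\ forall e : R, 0 < e -> exists N, forall p,
    (N <= p)%N -> (energy mu (fun x => (Tr (trunc p g) x - h x)%R) <= e%:E)%E.
  apply: riesz_fischer => [k|e e0]; first exact: TrM.
  (* The factor c + 1 is positive even if c vanishes. *)
  pose e' := e / (c + 1) ^+ 2.
  have c1 : 0 < c + 1 by rewrite ltr_wpDl.
  have e'0 : 0 < e' by rewrite divr_gt0 ?exprn_gt0.
  have [N NP] := energy_small (energy_truncB_cvg Lg) e'0.
  exists N => p q Np Nq.
  have e1 : 0 <= Num.sqrt e by exact: sqrtr_ge0.
  rewrite -(sqr_sqrtr (ltW e0)) -nrm_le_fin//.
  rewrite (@eq_nrm _ _ _ _ _ (Tr (fun x => trunc p g x - trunc q g x))); last first.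
    by move=> x; rewrite TrB.
  rewrite Tr_nrm; last exact: L2boxB.
  apply: (@le_trans _ _ (c%:E * (Num.sqrt e')%:E)%E).
    rewrite lee_wpmul2l ?lee_fin// nrm_le_fin ?sqrtr_ge0// sqr_sqrtr; last exact: ltW.
    apply: le_trans (NP N (leqnn N)); apply: le_energy.
    - by apply: cmeasB; apply: cmeas_trunc; case: Lg.
    - by apply: cmeasB; [apply: cmeas_trunc|]; case: Lg.
    - by move=> x; exact: sqn_truncBB_le.
  rewrite -EFinM lee_fin /e' (sqrtrM _ (ltW e0)) sqrtrV ?sqr_ge0// sqrtr_sqr gtr0_norm//.
  by rewrite mulrCA ler_piMr// ler_pdivrMr// mul1r lerDl.
have hcv : nrm mu (fun x => Tr (trunc N g) x - h x) @[N --> \oo] --> 0%E.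
  exact: nrm_cvg0.
exists h; split => //; split => //.
have [N NP] := hlim 1 ltr01.
apply: (le_lt_trans (nrmB_le mu mh (TrM (Lt N)))).
rewrite lte_add_pinfty//.
  rewrite Tr_nrm//; have [r [_ ff _]] := Lt N.
  by rewrite lte_mul_pinfty ?lee_fin ?nrm_lty.
by rewrite nrmB_sym nrm_lty (le_lt_trans (NP N (leqnn N)))// ltry.
Qed.

(** Norms are continuous along L2 limits, on both sides of the identity for the
truncations. *)
Lemma extension_nrm g h : L2 g -> is_extension g h ->
  L2norm h = (c%:E * L2norm g)%E.
Proof.
move=> Lg [[mh hfin] hcv]; have Lt N := L2box_trunc N Lg.
have c1 : nrm mu (Tr (trunc N g)) @[N --> \oo] --> nrm mu h.
  by apply: nrm_cvg => // k; exact: TrM.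
have c2 : nrm mu (Tr (trunc N g)) @[N --> \oo] --> (c%:E * nrm mu g)%E.
  have -> : (fun N => nrm mu (Tr (trunc N g))) = (fun N => c%:E * nrm mu (trunc N g))%E.
    by apply/funext => N; exact: Tr_nrm.
  by apply: cvgeZl => //; exact: nrm_trunc_cvg.
exact: (cvg_unique (@ereal_hausdorff R) c1 c2).
Qed.

End isometric_extension.

(** * The Fourier transform and its inverse on L2 *)

Section fourier_isometry.
Context {R : realType} {n : nat}.
Local Notation mu := (@rV_lebesgue R n).
Local Notation Re := (@complex.Re R).
Local Notation Im := (@complex.Im R).
Implicit Types f g h : 'rV[R]_n -> R[i].

Lemma fourierL1_ops :
  [/\ forall f, L2box f -> cmeas (fourierL1 f),
      forall f g, L2box f -> L2box g ->
        fourierL1 (fun x => f x - g x) =1 (fun x => fourierL1 f x - fourierL1 g x) &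
      forall f, L2box f -> nrm mu (fourierL1 f) = ((@plancherel_cst R n)%:E * nrm mu f)%E].
Proof.
split.
- by move=> f [r [mf _ _]]; exact: cmeas_fourierL1.
- by move=> f g Lf Lg x; exact: fourierL1B.
- exact: plancherel_L2box.
Qed.

(** Existence of the L2 limit means that the choice made in the definition of
[fourier] never falls back on the default value. *)
Lemma fourier_is_extension f : L2 f -> is_extension (@fourierL1 R n) f (fourier f).
Proof.
move=> Lf; have [h1 h2 h3] := fourierL1_ops.
have := extension_exists (plancherel_cst_ge0 (n := n)) h1 h2 h3 Lf.
exact: xgetPex.
Qed.

Lemma L2_fourier f : L2 f -> L2 (fourier f).
Proof. by move=> /fourier_is_extension[]. Qed.

Lemma L2norm_fourier f : L2 f ->
  L2norm (fourier f) = ((@plancherel_cst R n)%:E * L2norm f)%E.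
Proof.
move=> Lf; have [h1 h2 h3] := fourierL1_ops.
exact: (extension_nrm h1 h3 Lf (fourier_is_extension Lf)).
Qed.

Definition conjf f : 'rV[R]_n -> R[i] := fun x => Re (f x) -i* Im (f x).

Lemma sqn_conjf f x : sqn (conjf f x) = sqn (f x).
Proof. by rewrite /sqn /conjf/= sqrrN. Qed.

Lemma cmeas_conjf f : cmeas f -> cmeas (conjf f).
Proof. by move=> [f1 f2]; split => //=; exact: measurableT_comp. Qed.

Lemma L2box_conjf f : L2box f -> L2box (conjf f).
Proof.
move=> [r [mf ff fr]]; exists r; split.
- exact: cmeas_conjf.
- by under [energy _ _]eq_integral do rewrite sqn_conjf.
- by move=> x xr; rewrite /conjf fr//= oppr0.
Qed.

Definition inv_cst : R := ((2 * pi) ^+ n)^-1.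

(** Conjugation exchanges exp (i x xi) and exp (- i x xi), and preserves moduli.
All that is known about the direct transform passes in this way to the
inverse one. *)
Lemma inv_fourierL1E f x : L2box f ->
  inv_fourierL1 f x = inv_cst%:C * conjf (fourierL1 (conjf f)) x.
Proof.
move=> Lf; congr (_ * _).
have Lcf := L2box_conjf Lf.
have [i1 i2] := L2box_kernel_integrable x Lcf.
apply: complex_eq; rewrite /cintegral/=.
  apply: eq_Rintegral => y _.
  rewrite !cReM /conjf /expi/= cosN sinN.
  have -> : dotr y x = dotr x y by apply: eq_bigr => i _; rewrite mulrC.
  by rewrite mulrNN.
rewrite -mulN1r -RintegralZl//; apply: eq_Rintegral => y _.
rewrite !cImM /conjf /expi/= cosN sinN.
have -> : dotr y x = dotr x y by apply: eq_bigr => i _; rewrite mulrC.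
by ring.
Qed.

Definition inv_plancherel_cst : R := inv_cst * plancherel_cst (R := R) (n := n).

Lemma inv_plancherel_cst_gt0 : 0 < inv_plancherel_cst.
Proof.
by rewrite mulr_gt0 ?plancherel_cst_gt0// invr_gt0 exprn_gt0// mulr_gt0// pi_gt0.
Qed.

Lemma inv_fourierL1_ops :
  [/\ forall f, L2box f -> cmeas (inv_fourierL1 f),
      forall f g, L2box f -> L2box g -> inv_fourierL1 (fun x => f x - g x) =1
        (fun x => inv_fourierL1 f x - inv_fourierL1 g x) &
      forall f, L2box f -> nrm mu (inv_fourierL1 f) = (inv_plancherel_cst%:E * nrm mu f)%E].
Proof.
have [h1 h2 h3] := fourierL1_ops.
have m1 f : L2box f -> cmeas (conjf (fourierL1 (conjf f))).
  by move=> Lf; apply: cmeas_conjf; apply: h1; exact: L2box_conjf.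
have E f : L2box f -> inv_fourierL1 f =
    (fun x => inv_cst%:C * conjf (fourierL1 (conjf f)) x).
  by move=> Lf; apply/funext => x; exact: inv_fourierL1E.
split.
- by move=> f Lf; rewrite E//; apply: cmeasM => //; exact: m1.
- move=> f g Lf Lg x; rewrite !inv_fourierL1E//; last exact: L2boxB.
  rewrite -mulrBr; congr (_ * _).
  have -> : conjf (fun x => f x - g x) = (fun x => conjf f x - conjf g x).
    apply/funext => y; apply: complex_eq; rewrite /conjf/= ?cReB ?cImB//=.
    by rewrite ?cReB ?cImB//=; ring.
  rewrite [in LHS]/conjf h2//; [|exact: L2box_conjf|exact: L2box_conjf].
  apply: complex_eq; rewrite /conjf/= ?cReB ?cImB//=.
  by rewrite ?cReB ?cImB//=; ring.
- move=> f Lf; rewrite E//.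
  have i0 : 0 <= inv_cst by rewrite invr_ge0 exprn_ge0// mulr_ge0// pi_ge0.
  transitivity (inv_cst%:E * nrm mu (conjf (fourierL1 (conjf f))))%E.
    apply: nrm_scale => //; rewrite energyZ; last exact: m1.
    by rewrite /sqn/= expr0n/= addr0.
  have nc g : nrm mu (conjf g) = nrm mu g.
    by rewrite !nrmE; congr sqrte; apply: eq_integral => x _; rewrite sqn_conjf.
  by rewrite nc h3 ?nc; [rewrite EFinM muleA|exact: L2box_conjf].
Qed.

Lemma L2norm_inv_fourier f : L2 f ->
  L2norm (inv_fourier f) = (inv_plancherel_cst%:E * L2norm f)%E.
Proof.
move=> Lf; have [h1 h2 h3] := inv_fourierL1_ops.
apply: (extension_nrm h1 h3 Lf).
have := extension_exists (ltW inv_plancherel_cst_gt0) h1 h2 h3 Lf.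
exact: xgetPex.
Qed.

End fourier_isometry.

(** * Comparison of norms *)

Section more_norms.
Context {R : realType} d (T : measurableType d) (mu : {measure set T -> \bar R}).
Implicit Types f g : T -> R[i].

(** Hölder's inequality for the exponents 2 and 2. *)
Lemma cauchy_schwarz f g : cmeas f -> cmeas g ->
  (\int[mu]_x (Normc.normc (f x) * Normc.normc (g x))%:E <= nrm mu f * nrm mu g)%E.
Proof.
move=> mf mg.
have half2 : (2^-1 + 2^-1 = 1 :> R)%R by lra.
have := hoelder mu (measurable_normc mf) (measurable_normc mg) (ltr0n _ 2) (ltr0n _ 2) half2.
rewrite Lnorm1; apply: le_trans; rewrite le_eqVlt; apply/orP; left; apply/eqP.
by apply: eq_integral => x _ /=; rewrite ger0_norm// mulr_ge0 ?normc_ge0.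
Qed.

Lemma nrm_le_scale f g (c : R) : 0 <= c ->
  (nrm mu f <= c%:E * nrm mu g)%E = (energy mu f <= (c ^+ 2)%:E * energy mu g)%E.
Proof.
move=> c0; rewrite !nrmE -[in LHS](gee0_abs (x := c%:E)) ?lee_fin// -sqrte_sqr.
rewrite -sqrteM ?expe2 -?EFinM ?lee_fin ?sqr_ge0// -?expr2 lee_sqrt//.
by rewrite mule_ge0 ?lee_fin ?sqr_ge0 ?energy_ge0.
Qed.

Lemma energy_scale f g (c : R) :
  nrm mu f = (c%:E * nrm mu g)%E -> energy mu f = ((c ^+ 2)%:E * energy mu g)%E.
Proof.
rewrite !nrmE => fg.
rewrite -[LHS]sqr_sqrte ?energy_ge0// fg -[in RHS](sqr_sqrte (energy_ge0 mu g)).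
by rewrite !expe2 muleACA -EFinM -expr2.
Qed.

Lemma energy_split f g h (D : R) : cmeas f -> cmeas g -> cmeas h -> 0 <= D ->
  (forall x, sqn (f x) <= sqn (g x) + D * sqn (h x)) ->
  (energy mu f <= energy mu g + D%:E * energy mu h)%E.
Proof.
move=> mf mg mh D0 H; have msf := measurable_sqn mf.
have msg := measurable_sqn mg; have msh := measurable_sqn mh.
rewrite /energy -ge0_integralZl//; last 2 first.
- exact/measurable_EFinP.
- by move=> x _; rewrite lee_fin sqn_ge0.
rewrite -ge0_integralD//; last 4 first.
- by move=> x _; rewrite lee_fin sqn_ge0.
- exact/measurable_EFinP.
- by move=> x _; rewrite -EFinM lee_fin mulr_ge0// sqn_ge0.
- by apply/measurable_EFinP; exact: measurable_funM.
apply: ge0_le_integral => //.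
- by move=> x _; rewrite lee_fin sqn_ge0.
- exact/measurable_EFinP.
- by apply/measurable_EFinP; apply: measurable_funD => //; exact: measurable_funM.
- by move=> x _; rewrite -EFinM -EFinD lee_fin.
Qed.

End more_norms.

(** * The essential support *)

Section support.
Context {R : realType} {n : nat}.
Local Notation mu := (@rV_lebesgue R n).

Lemma coord_le_norm (x : 'rV[R]_n) i : `|x ord0 i| <= `|x|.
Proof.
by rewrite [leRHS]/Num.norm /= mx_normrE; apply/bigmax_geP; right => /=; exists (ord0, i).
Qed.

Lemma negligible_seq_cover (s : seq (set 'rV[R]_n)) (P : set 'rV[R]_n) :
  (forall U, U \in s -> mu.-negligible (U `&` P)) ->
  mu.-negligible ((\bigcup_(U in [set` s]) U) `&` P).
Proof.
elim: s => [|U s IH] H.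
  rewrite (_ : [set` [::]] = set0); last by apply/seteqP; split.
  by rewrite bigcup_set0 set0I; exact: negligible_set0.
apply: (@negligibleS _ _ _ mu ((U `&` P) `|` ((\bigcup_(V in [set` s]) V) `&` P))).
  move=> x [[V /=]]; rewrite inE => /orP[/eqP ->|Vs] Vx Px; first by left.
  by right; split => //; exists V.
apply: negligibleU; first by apply: H; rewrite mem_head.
by apply: IH => V Vs; apply: H; rewrite inE Vs orbT.
Qed.

(** The complement of the support is a union of arbitrarily many open sets on
which u vanishes almost everywhere.  A compact set needs only finitely many of
them, so that no uncountable union of null sets occurs. *)
Lemma spt_compact_disjoint (u : 'rV[R]_n -> R[i]) (A : set 'rV[R]_n) :
  compact A -> A `<=` ~` spt u -> mu.-negligible (A `&` [set x | u x <> 0]).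
Proof.
rewrite compact_cover => cA Asub.
pose D : set (set 'rV[R]_n) := [set U | open U /\ {ae mu, forall x, U x -> u x = 0}].
have [|x Ax|D' D'D AD'] := cA (set 'rV[R]_n : choiceType) D id.
- by move=> U [].
- by have := Asub x Ax; rewrite /spt setCK.
have : mu.-negligible ((\bigcup_(U in [set` (finmap.enum_fset D')]) U) `&` [set x | u x <> 0]).
  apply: negligible_seq_cover => U UD'.
  have /D'D := UD'; rewrite inE => -[_].
  by apply: negligibleS => x /= [Ux ux] h; apply: ux; exact: h.
by apply: negligibleS => x [/AD' [U UD' Ux] ux]; split => //; exists U.
Qed.

(** For the sup norm, the complement of the open ball of radius r is the union of the countably
many compact annuli r <= |x| <= k, each disjoint from the support. *)
Lemma spt_bounded (u : 'rV[R]_n -> R[i]) (K : set 'rV[R]_n) (M r : R) :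
  (forall x, K x -> `|x| <= M) -> M < r -> spt u `<=` K ->
  {ae mu, forall x, ~ box n r x -> u x = 0}.
Proof.
move=> KM Mr uK.
pose A k : set 'rV[R]_n := [set x | r <= `|x|] `&` [set x | `|x| <= k%:R].
have cA k : compact (A k).
  apply: bounded_closed_compact.
    exists k%:R; split; first exact: num_real.
    by move=> y ky x [_ xk]; exact: le_trans xk (ltW ky).
  apply: closedI.
    apply: (@preimage_closed _ _ _ [set y : R | r <= y]); last exact: closed_ge.
    by move=> x _; exact: norm_continuous.
  apply: (@preimage_closed _ _ _ [set y : R | y <= k%:R]); last exact: closed_le.
  by move=> x _; exact: norm_continuous.
have nA k : mu.-negligible (A k `&` [set x | u x <> 0]).
  apply: spt_compact_disjoint => // x [rx _] /uK /KM.
  by rewrite leNgt (lt_le_trans Mr).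
apply: negligibleS (negligible_bigcup nA) => x /= h.
have [xr ux] : ~ box n r x /\ u x <> 0.
  by split=> [h'|h']; apply: h => // /(_ h').
exists (Num.truncn `|x|).+1 => //; split => //; split => /=.
  move/existsNP : xr => [i /negP]; rewrite -ltNge => ri.
  exact: le_trans (ltW ri) (coord_le_norm x i).
by rewrite ltW// truncnS_gt.
Qed.

End support.

(** * Low frequencies of compactly supported functions *)

Section low_frequencies.
Context {R : realType} {n : nat}.
Local Notation mu := (@rV_lebesgue R n).
Implicit Types u w : 'rV[R]_n -> R[i].

Definition boxf (r : R) : 'rV[R]_n -> R[i] := fun x => (\1_(box n r) x)%:C.

Lemma cmeas_boxf r : cmeas (boxf r).
Proof. by apply: cmeas_real; apply: measurable_indic; exact: measurable_box. Qed.

Lemma sqn_boxf r x : sqn (boxf r x) = \1_(box n r) x.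
Proof.
rewrite /sqn /boxf/= expr0n/= addr0 indicE; case: (_ \in _) => /=.
  by rewrite expr1n.
by rewrite expr0n.
Qed.

Lemma normc_boxf r x : Normc.normc (boxf r x) = \1_(box n r) x.
Proof. by rewrite /boxf/= expr0n/= addr0 sqrtr_sqr ger0_norm. Qed.

Lemma nrm_boxf r : 0 <= r -> nrm mu (boxf r) = (Num.sqrt ((2 * r) ^+ n))%:E.
Proof.
move=> r0; rewrite nrmE /energy; under eq_integral do rewrite sqn_boxf.
rewrite integral_indic//; last exact: measurable_box.
by rewrite setIT [X in sqrte X]measure_box.
Qed.

(** The Cauchy-Schwarz inequality against the indicator function of the box. *)
Lemma trunc_L1_le u r N : L2 u -> 0 <= r ->
  {ae mu, forall x, ~ box n r x -> u x = 0} ->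
  (\int[mu]_x (Normc.normc (trunc N u x))%:E <= nrm mu u * (Num.sqrt ((2 * r) ^+ n))%:E)%E.
Proof.
move=> Lu r0 ur; have [mu_ fu] := Lu.
have mt := cmeas_trunc N mu_.
have -> : (\int[mu]_x (Normc.normc (trunc N u x))%:E =
    \int[mu]_x (Normc.normc (trunc N u x) * Normc.normc (boxf r x))%:E)%E.
  apply: ge0_ae_eq_integral => //.
  - by apply/measurable_EFinP; exact: measurable_normc.
  - apply/measurable_EFinP; apply: measurable_funM; apply: measurable_normc => //.
    exact: cmeas_boxf.
  - by move=> x _; rewrite lee_fin normc_ge0.
  - by move=> x _; rewrite lee_fin mulr_ge0 ?normc_ge0.
  - apply: filterS ur => x ux _; rewrite normc_boxf indicE.
    case: (boolP (x \in _)) => [_|/negP xr]; first by rewrite mulr1.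
    by rewrite /trunc ux ?if_same ?Normc.normc0 ?mul0r// => h; apply: xr; rewrite inE.
apply: (le_trans (cauchy_schwarz mu mt (cmeas_boxf r))).
rewrite nrm_boxf// lee_wpmul2r ?lee_fin ?sqrtr_ge0// nrm_le.
by apply: le_energy => // x; exact: sqn_trunc_le.
Qed.

(** The transform of u is bounded by 2 |u|_1 <= 2 ((2 r)^n)^(1/2) |u|_2, and the
box of half-side del has volume (2 del)^n.  As [fourier u] is only known as an
L2 limit, the bound is proved for the truncations, uniformly, and passes to
the limit after multiplication by the indicator function of the box. *)
Lemma low_frequency u r del : L2 u -> 0 <= r -> 0 <= del ->
  {ae mu, forall x, ~ box n r x -> u x = 0} ->
  (energy mu (fun xi => boxf del xi * fourier u xi)%R <=
   (4 * (2 * r) ^+ n * (2 * del) ^+ n)%:E * energy mu u)%E.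
Proof.
move=> Lu r0 d0 ur; have [mu_ fu] := Lu.
have [[mw fw] wcv] := fourier_is_extension Lu.
set w := fourier u in mw fw wcv *.
pose F N := fourierL1 (trunc N u).
have mF N : cmeas (F N) by apply: cmeas_fourierL1; exact: cmeas_trunc.
have nu : nrm mu u \is a fin_num by rewrite ge0_fin_numE// nrm_ge0.
pose V := Num.sqrt ((2 * r) ^+ n).
pose A := 2 * (fine (nrm mu u) * V).
have A0 : 0 <= A by rewrite !mulr_ge0 ?sqrtr_ge0 ?fine_ge0 ?nrm_ge0.
(* Bound of the transform by the L1 norm, uniformly in N. *)
have FA N xi : Normc.normc (F N xi) <= A.
  have Lt := L2box_trunc N Lu; have It := L2box_integrable Lt.
  apply: (@le_trans _ _ (2 * \int[mu]_x Normc.normc (trunc N u x))).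
    apply: (@normc_cint_le _ _ _ mu) => //.
    - apply: cmeasM; last exact: cmeas_trunc.
      by apply: cmeas_expi; apply: measurableT_comp => //; exact: measurable_dotr.
    - by move=> x; rewrite Normc.normcM normc_expi mul1r.
  rewrite ler_wpM2l// -lee_fin EFinM fineK//; last exact: integrable_fin_num.
  rewrite fineK//; exact: trunc_L1_le.
pose cut f (xi : 'rV[R]_n) := boxf del xi * f xi.
have mcut f : cmeas f -> cmeas (cut f) by move=> mf; apply: cmeasM => //; exact: cmeas_boxf.
have cut_le f xi : sqn (cut f xi) <= sqn (f xi).
  rewrite /cut sqnM sqn_boxf ler_piMl ?sqn_ge0// indicE lern1 leq_b1//.
have fcut : (nrm mu (cut w) < +oo)%E.
  rewrite nrm_lty; apply: le_lt_trans (L2_energy (conj mw fw)).2.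
  by apply: le_energy => //; exact: mcut.
have cv : nrm mu (cut (F N)) @[N --> \oo] --> nrm mu (cut w).
  apply: nrm_cvg => //; [by move=> N; exact: mcut|exact: mcut|].
  apply: (squeeze_cvge _ (cvg_cst 0%E) wcv); apply: nearW => N.
  rewrite nrm_ge0 andTb.
  rewrite (@eq_nrm _ _ _ _ _ (cut (fun xi => F N xi - w xi))); last first.
    by move=> xi; rewrite /cut mulrBr.
  rewrite [leRHS](_ : _ = nrm mu (fun xi => F N xi - w xi))// nrm_le.
  by apply: le_energy; [apply: mcut; exact: cmeasB|exact: cmeasB|move=> x; exact: cut_le].
have bd N : (nrm mu (cut (F N)) <= (A * Num.sqrt ((2 * del) ^+ n))%:E)%E.
  rewrite EFinM -nrm_boxf// nrm_le_scale// /energy -ge0_integralZl//; last 3 first.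
  - by apply/measurable_EFinP; apply: measurable_sqn; exact: cmeas_boxf.
  - by move=> x _; rewrite lee_fin sqn_ge0.
  - by rewrite lee_fin sqr_ge0.
  apply: ge0_le_integral => //.
  - by move=> x _; rewrite lee_fin sqn_ge0.
  - by apply/measurable_EFinP; apply: measurable_sqn; exact: mcut.
  - apply/measurable_EFinP; apply: measurable_funM => //.
    by apply: measurable_sqn; exact: cmeas_boxf.
  - move=> x _; rewrite -EFinM lee_fin /cut sqnM mulrC ler_wpM2r ?sqn_ge0//.
    by rewrite -sqnE lerXn2r ?nnegrE ?normc_ge0.
have : (nrm mu (cut w) <= (A * Num.sqrt ((2 * del) ^+ n))%:E)%E.
  rewrite -(cvg_lim _ cv)//; apply: lime_le; first by apply/cvg_ex; eexists; exact: cv.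
  exact: nearW.
have -> : ((A * Num.sqrt ((2 * del) ^+ n))%:E =
    (2 * V * Num.sqrt ((2 * del) ^+ n))%:E * nrm mu u)%E.
  by rewrite -[X in (_ * X)%E]fineK// -EFinM; congr EFin; rewrite /A; ring.
rewrite nrm_le_scale; last by rewrite !mulr_ge0 ?sqrtr_ge0.
have sq t : 0 <= t -> Num.sqrt ((2 * t) ^+ n) ^+ 2 = (2 * t) ^+ n.
  by move=> t0; rewrite sqr_sqrtr// exprn_ge0// mulr_ge0.
rewrite [(_ * _ * _) ^+ 2]exprMn [(_ * _) ^+ 2]exprMn /V !sq//.
by rewrite (_ : 2 ^+ 2 = 4 :> R)//; ring.
Qed.

End low_frequencies.

(** * Fourier multipliers *)

Section frequency_weights.
Context {R : realType} {n : nat}.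
Local Notation mu := (@rV_lebesgue R n).
Implicit Types u w : 'rV[R]_n -> R[i].

(** Multiplication by the symbol of (-Delta)^(a/2). *)
Definition freq (a : R) w : 'rV[R]_n -> R[i] := fun xi => (euclid xi `^ a)%:C * w xi.

Lemma euclid_ge0 (x : 'rV[R]_n) : 0 <= euclid x. Proof. exact: sqrtr_ge0. Qed.

Lemma cmeas_freq a w : cmeas w -> cmeas (freq a w).
Proof.
move=> mw; apply: cmeasM => //; apply: cmeas_real.
exact: (measurableT_comp (measurable_powR a) measurable_euclid).
Qed.

Lemma sqn_freq a w xi : sqn (freq a w xi) = (euclid xi `^ a) ^+ 2 * sqn (w xi).
Proof. by rewrite /freq sqnM {1}/sqn/= expr0n/= addr0. Qed.

Lemma fractional_laplacianE a u :
  fractional_laplacian (a / 2) u = inv_fourier (freq a (fourier u)).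
Proof. by rewrite /fractional_laplacian mulrC divfK. Qed.

(** The weight defining H^s dominates: |xi|^t <= (1 + |xi|^2)^(t/2), which is at
most (1 + |xi|^2)^(s/2). *)
Lemma L2_freq s t u : 0 <= t -> t <= s -> sobolev s u -> L2 (freq t (fourier u)).
Proof.
move=> t0 ts [Lu [ms fs]].
have [mw fw] := L2_fourier Lu.
split; first exact: cmeas_freq.
apply: le_lt_trans fs; rewrite [X in (X <= _)%E](_ : _ = nrm mu (freq t (fourier u)))//.
rewrite [leRHS](_ : _ = nrm mu (fun xi =>
  ((1 + euclid xi ^+ 2) `^ (s / 2))%:C * fourier u xi))// nrm_le.
apply: le_energy => //; first exact: cmeas_freq.
move=> xi; rewrite sqn_freq sqnM ler_wpM2r ?sqn_ge0//.
rewrite {1}/sqn/= expr0n/= addr0 lerXn2r ?nnegrE ?powR_ge0//.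
have e0 := euclid_ge0 xi.
have -> : euclid xi `^ t = (euclid xi ^+ 2) `^ (t / 2).
  by rewrite -powR_mulrn// -powRrM mulrC divfK.
apply: (@le_trans _ _ ((1 + euclid xi ^+ 2) `^ (t / 2))).
  apply: ge0_ler_powR; rewrite ?nnegrE ?divr_ge0 ?addr_ge0 ?sqr_ge0//.
  by rewrite lerDr.
by apply: ler_powR; rewrite ?lerDl ?sqr_ge0// ler_wpM2r.
Qed.

(** |xi|^(2t) <= 1 where |xi| <= 1, and |xi|^(2t) <= |xi|^(2s) elsewhere. *)
Lemma energy_freq_le s t w : 0 <= t -> t <= s -> cmeas w ->
  (energy mu (freq t w) <= energy mu w + energy mu (freq s w))%E.
Proof.
move=> t0 ts mw; have := @energy_split R _ _ mu (freq t w) w (freq s w) 1.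
rewrite mul1e; apply => //; [exact: cmeas_freq|exact: cmeas_freq|].
move=> xi; rewrite mul1r !sqn_freq -[X in _ <= X + _]mul1r -mulrDl.
rewrite ler_wpM2r ?sqn_ge0//; have [e1|e1] := leP (euclid xi) 1.
  rewrite (@le_trans _ _ 1)// ?lerDl ?sqr_ge0// expr_le1 ?powR_ge0//.
  have := @ge0_ler_powR _ t t0 (euclid xi) 1; rewrite powR1; apply => //.
    by rewrite nnegrE euclid_ge0.
  by rewrite nnegrE.
rewrite -[leLHS]add0r lerD// lerXn2r ?nnegrE ?powR_ge0//.
by apply: ler_powR => //; exact: ltW.
Qed.

End frequency_weights.

(** * The Poincare inequality and its consequence *)

Lemma le_of_le_half_add (R : realType) (x y : R) : x <= 2^-1 * x + y -> x <= 2 * y.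
Proof. by lra. Qed.

(** With del small enough the low frequencies hold at most half of the energy of
û; this half is absorbed, and the remaining frequencies are at least del.  The
choice of del depends on r and n only. *)
Lemma poincare (R : realType) (n : nat) (r : R) : (0 < n)%N -> 0 < r ->
  exists del : R, 0 < del /\ forall (s : R) (u : 'rV[R]_n -> R[i]), 0 <= s ->
    sobolev s u -> {ae rV_lebesgue R n, forall x, ~ box n r x -> u x = 0} ->
    (energy (rV_lebesgue R n) (fourier u) <=
     (2 * ((del `^ s)^-1) ^+ 2)%:E *
       energy (rV_lebesgue R n) (freq s (fourier u)))%E.
Proof.
move=> n0 r0.
pose kap := (2 * pi) ^+ n : R; pose V := (2 * r) ^+ n.
have kap0 : 0 < kap by rewrite exprn_gt0// mulr_gt0// pi_gt0.
have V0 : 0 < V by rewrite exprn_gt0// mulr_gt0.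
(* With 2 del <= 1 one has (2 del)^n <= 2 del, and then
   4 V (2 del) <= kap / 2. *)
pose del : R := Num.min 2^-1 (kap / (16 * V)).
have d0 : 0 < del by rewrite lt_min invr_gt0 ltr0n divr_gt0// mulr_gt0.
have d00 : 0 <= 2 * del by rewrite mulr_ge0// ltW.
have V4 : 0 <= 4 * V by rewrite mulr_ge0// ltW.
have dsmall : 4 * V * (2 * del) ^+ n <= kap / 2.
  have d1 : 2 * del <= 1.
    by rewrite mulrC -ler_pdivlMr// mul1r ge_min lexx.
  have d2 : (2 * del) ^+ n <= 2 * del.
    by rewrite -(prednK n0) exprS ler_piMr// exprn_ile1.
  apply: (@le_trans _ _ (4 * V * (2 * del))).
    by rewrite ler_wpM2l.
  have d3 : del <= kap / (16 * V) by rewrite ge_min lexx orbT.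
  apply: (@le_trans _ _ (4 * V * (2 * (kap / (16 * V))))).
    by rewrite ler_wpM2l// ler_wpM2l.
  by rewrite le_eqVlt; apply/orP; left; apply/eqP; field; rewrite gt_eqF.
exists del; split => // s u s0 su ur.
have Lu : L2 u by case: su.
have [mw fw] := L2_fourier Lu.
have [ms fs] := L2_freq s0 (lexx s) su.
set w := fourier u in mw fw ms fs *.
have Ew : (energy (rV_lebesgue R n) w = kap%:E * energy (rV_lebesgue R n) u)%E.
  by rewrite /kap -plancherel_cst_sqr; apply: energy_scale; exact: L2norm_fourier.
have ew : energy (rV_lebesgue R n) w \is a fin_num.
  by rewrite ge0_fin_numE ?energy_ge0// -nrm_lty.
have es : energy (rV_lebesgue R n) (freq s w) \is a fin_num.
  by rewrite ge0_fin_numE ?energy_ge0// -nrm_lty.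
have low : (energy (rV_lebesgue R n) (fun xi => boxf del xi * w xi)%R <=
    2^-1%:E * energy (rV_lebesgue R n) w)%E.
  apply: (le_trans (low_frequency Lu (ltW r0) (ltW d0) ur)).
  rewrite Ew muleA -EFinM lee_wpmul2r ?energy_ge0// lee_fin [2^-1 * _]mulrC.
  exact: dsmall.
have split : (energy (rV_lebesgue R n) w <=
    energy (rV_lebesgue R n) (fun xi => boxf del xi * w xi)%R +
    (((del `^ s)^-1) ^+ 2)%:E * energy (rV_lebesgue R n) (freq s w))%E.
  (* Off the box some coordinate, and hence |xi|, exceeds del. *)
  apply: energy_split => //.
  - by apply: cmeasM => //; exact: cmeas_boxf.
  - by rewrite sqr_ge0.
  - move=> xi; rewrite sqnM sqn_boxf sqn_freq indicE mulrA -mulrDl.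
    rewrite -[leLHS]mul1r ler_wpM2r ?sqn_ge0//.
    case: (boolP (xi \in _)) => [_|/negP xid]; first by rewrite lerDl mulr_ge0 ?sqr_ge0.
    rewrite add0r -exprMn expr_ge1 ?mulr_ge0 ?invr_ge0 ?powR_ge0//.
    rewrite mulrC ler_pdivlMr ?powR_gt0// mul1r.
    have /existsNP[i /negP] : ~ box n del xi by move=> h; apply: xid; rewrite inE.
    rewrite -ltNge => di; apply: ge0_ler_powR; rewrite ?nnegrE ?euclid_ge0// ?(ltW d0)//.
    exact: le_trans (ltW di) (coord_le_euclid xi i).
have := le_trans split (leeD low (lexx _)).
rewrite -(fineK ew) -(fineK es) -!EFinM -EFinD !lee_fin => h.
by rewrite -mulrA; exact: le_of_le_half_add h.
Qed.

Lemma L2norm_fractional_laplacian (R : realType) (n : nat) (a : R)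
    (u : 'rV[R]_n -> R[i]) : L2 (freq a (fourier u)) ->
  L2norm (fractional_laplacian (a / 2) u) =
  ((@inv_plancherel_cst R n)%:E * nrm (rV_lebesgue R n) (freq a (fourier u)))%E.
Proof. by move=> La; rewrite fractional_laplacianE; exact: L2norm_inv_fourier. Qed.

Lemma le_common_factor (R : realType) (k c : R) (a b x y : \bar R) : 0 <= k ->
  a = (k%:E * x)%E -> b = (k%:E * y)%E -> (x <= c%:E * y)%E -> (a <= c%:E * b)%E.
Proof. by move=> k0 -> -> xy; rewrite muleCA lee_wpmul2l// lee_fin. Qed.

Theorem theorem1p5 (R : realType) (n : nat) (s : R) (K : set 'rV[R]_n) :
  (1 <= n)%N -> 0 <= s -> compact K ->
  exists c : R, 0 < c /\
    forall (t : R) (u : 'rV[R]_n -> R[i]),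
      0 <= t -> t <= s -> sobolev_in s K u ->
      (L2norm (fractional_laplacian (t / 2) u) <=
         c%:E * L2norm (fractional_laplacian (s / 2) u))%E.
Proof.
move=> n0 s0 /compact_bounded [M [_ KM]].
(* The closed sup-norm ball of radius |M| + 1 contains K; the box must be strictly
   larger. *)
pose r := `|M| + 2.
have r0 : 0 < r by rewrite ltr_wpDl.
have [del [d0 P]] := poincare n0 r0.
pose D := 1 + 2 * ((del `^ s)^-1) ^+ 2.
have D0 : 0 < D by rewrite ltr_pwDl// mulr_ge0// sqr_ge0.
exists (Num.sqrt D); split; first by rewrite sqrtr_gt0.
move=> t u t0 ts [su uK]; have Lu : L2 u by case: su.
have ur : {ae rV_lebesgue R n, forall x, ~ box n r x -> u x = 0}.
  apply: (spt_bounded (M := `|M| + 1) _ _ uK); last by rewrite ltrD2l ltr1n.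
  by apply: KM; rewrite (le_lt_trans (ler_norm M))// ltrDl.
have [mw fw] := L2_fourier Lu.
have Ls := L2_freq s0 (lexx s) su; have Lt := L2_freq t0 ts su.
apply: (le_common_factor _ (L2norm_fractional_laplacian Lt) (L2norm_fractional_laplacian Ls)).
  exact: ltW inv_plancherel_cst_gt0.
rewrite nrm_le_scale ?sqrtr_ge0// (sqr_sqrtr (ltW D0)).
apply: (le_trans (energy_freq_le t0 ts mw)).
have -> : D%:E = (1%:E + (2 * ((del `^ s)^-1) ^+ 2)%:E)%E by [].
rewrite ge0_muleDl ?lee_fin ?mulr_ge0 ?invr_ge0 ?powR_ge0//.
rewrite mul1e addeC leeD2l//; exact: P.
Qed.
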